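(* Let $y\in[2,x]$ and let $A$ be a random variable taking values in $[1,x]\cap\mathbb{N}$. Let $(\mathrm{Geom}_p)_{p\le y}$ be independent random variables, indexed by the primes $p\le y$, with $\mathbb{P}(\mathrm{Geom}_p=k)=p^{-k}(1-1/p)$ for all integers $k\ge 0$. Let $u=\log x/\log y$. For every $\theta\in(0,1)$ and $\varepsilon>0$, we have $$\mathrm{d}_{\mathrm{TV}}\big((\nu_p(A))_{p\le y},(\mathrm{Geom}_p)_{p\le y}\big)\ll_{\theta,\varepsilon}u^{-\theta u(1-\varepsilon)}+x^{-\theta(1-\varepsilon)}+x^{1/\log\log x}\sum_{\substack{d\le x^{\theta}\\ P(d)\le y}}\left|\mathbb{P}(d\mid A)-\frac1d\right|.$$
   Context: $\mathbb{N}=\{1,2,\dots\}$; $d$ runs over positive integers and $p$ over primes. $\nu_p(n)$ is the exponent of $p$ in $n$. $P(d)$ is the largest prime divisor of $d$, with $P(1)=1$. $\mathbb{P}(d\mid A)$ is the probability that $d$ divides $A$. For discrete random variables $X,Y$ with values in a countable set $\Omega$, $\mathrm{d}_{\mathrm{TV}}(X,Y)=\sup_{E\subseteq\Omega}|\mathbb{P}(X\in E)-\mathbb{P}(Y\in E)|$. $F\ll_{\theta,\varepsilon}G$ means $|F|\le C\,G$ with a constant $C$ depending only on $\theta,\varepsilon$. For $x=e$, where $1/\log\log x$ is undefined, the factor $x^{1/\log\log x}$ is read as $1$. *)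

(* Defs.v *)
From HB Require Import structures.
From mathcomp Require Import all_boot all_order all_algebra.
From mathcomp Require Import all_classical all_reals all_analysis.

Set Implicit Arguments.
Unset Strict Implicit.
Unset Printing Implicit Defensive.

Import Order.TTheory GRing.Theory Num.Theory.
Local Open Scope classical_set_scope.
Local Open Scope ring_scope.

(* For y >= 0, an integer p satisfies p <= y iff p < (Num.truncn y).+1. *)
Definition prime_upto (R : realType) (y : R) : Type :=
  {p : 'I_(Num.truncn y).+1 | prime p}.

HB.instance Definition _ (R : realType) (y : R) :=
  Finite.copy (prime_upto y) {p : 'I_(Num.truncn y).+1 | prime p}.

Definition prime_val (R : realType) (y : R) (p : prime_upto y) : nat :=
  \val (\val p).
Coercion prime_val : prime_upto >-> nat.

(* X and Y may live on different probability spaces.  The definition is meant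
   for discrete random variables, for which all the events X \in E and Y \in E
   are measurable; the set of differences is then a subset of [0, 1]. *)
Definition dTV (R : realType) (Omega : countType)
    (d1 : measure_display) (T1 : measurableType d1) (P1 : probability T1 R)
    (X : T1 -> Omega)
    (d2 : measure_display) (T2 : measurableType d2) (P2 : probability T2 R)
    (Y : T2 -> Omega) : R :=
  sup [set `| fine (P1 (X @^-1` E)) - fine (P2 (Y @^-1` E)) |
      | E in [set: set Omega]].

Definition mutually_independent (R : realType) (d d' : measure_display)
    (T : measurableType d) (T' : measurableType d') (P : probability T R)
    (I : finType) (X : I -> {RV P >-> T'}) : Prop :=
  forall (J : {set I}) (E : I -> set T'),
    (forall i, measurable (E i)) ->
    P [set t | forall i, i \in J -> E i (X i t)] =
      (\prod_(i in J) P (X i @^-1` E i))%E.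

Definition geometric_law (R : realType) (d : measure_display)
    (T : measurableType d) (P : probability T R) (p : nat)
    (X : {RV P >-> nat}) : Prop :=
  forall k : nat,
    P (X @^-1` [set k]) = (p%:R ^- k * (1 - p%:R^-1))%:E.

Definition valuation_vector (R : realType) (y : R) (T : Type) (A : T -> nat)
    (t : T) : {ffun prime_upto y -> nat} :=
  [ffun p : prime_upto y => logn p (A t)].

Definition family_vector (I : finType) (T : Type) (X : I -> T -> nat) (t : T) :
    {ffun I -> nat} :=
  [ffun i => X i t].

(* x ^ (1 / log log x); at x = e this is x ^ 0 = 1, because 0^-1 = 0. *)
Definition loglog_factor (R : realType) (x : R) : R :=
  x `^ (ln (ln x))^-1.

(* The sum runs over the d >= 1 with d <= x ^ theta and P(d) <= y; note that
   max_pdiv 1 = 1. *)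
Definition divisibility_discrepancy (R : realType) (d : measure_display)
    (T : measurableType d) (P : probability T R) (A : T -> nat)
    (x y theta : R) : R :=
  \sum_(1 <= n < (Num.truncn (x `^ theta)).+1 | (max_pdiv n)%:R <= y)
     `| fine (P [set t | (n %| A t)%N]) - n%:R^-1 |.

(* Main.v *)
Require Import Defs.
From HB Require Import structures.
From mathcomp Require Import all_boot all_order all_algebra.
From mathcomp Require Import all_classical all_reals all_analysis.
From mathcomp Require Import ring lra zify.

Set Implicit Arguments.
Unset Strict Implicit.
Unset Printing Implicit Defensive.

Import Order.TTheory GRing.Theory Num.Theory.
Local Open Scope classical_set_scope.
Local Open Scope ring_scope.

(** A one-sided lower bound for the point probabilities of the valuation vector
    controls the total variation distance, because both laws have mass [1]. For
    an exponent vector [v] put [n = \prod_p p ^ v p]. The integer [A] has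
    valuation vector [v] iff [n] divides [A] and [A / n] has no prime factor up to
    [y]. Any lower bound sieve [\sum_e (-1) ^ omega(e)] for the second
    condition bounds the probability of [v] from below by a signed sum of
    probabilities of divisibility by [n * e]; replacing each of them by
    [1 / (n * e)] costs the discrepancies at [m = n * e], and each [m] arises at
    most [2 ^ omega(m)] times ([sum_sieve_remainders]). Since a product of [k]
    distinct primes is at least [k!], this is at most [x ^ (1 / log log x)] for
    large [x] ([two_expn_count_primes]).

    What remains is the main term of the sieve under the constraint
    [n * e <= x ^ theta]. It is Brun's sieve with a room depending on [n]: the
    first [b] primes chosen, where [b] is about [log (x ^ theta / n) / log y], are
    unrestricted, and afterwards the largest prime that may be chosen drops to its
    square root every [B] choices. By Rankin's trick with a weight [T] per chosen
    prime, the relative error is [O(T ^ - b)] once [B] is a large multiple of [T]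
    ([brun_sum_error], [brun_density]); the only input on primes is
    [\sum_(p <= z) log p / p <= 2 log z], which follows from the factorization of
    [z!]. As [T ^ - b] is about [T ^ (log n / log y)] times [T ^ (- theta u)],
    summing over [n] gives a moment of [\prod_p p ^ Geom_p], an Euler product of
    size [exp (O(T log T))] ([euler_product_moment], [sum_box_moment]). The tail
    of large [n] needs no separate treatment, since there the same bound exceeds
    [1].

    The total is [T ^ (- theta u + O(T))]. Taking for [T] the smaller of
    [u ^ (1 - eps / 2)] and [y ^ (1 - eps / 2)] makes [O(T)] negligible against
    [u] and produces the first two terms of the theorem ([rankin_decay]). For
    bounded [u] or bounded [x] one of these two terms is bounded below, and a
    distance is at most [1]. *)

(** * Primes and a bound of Mertens type *)

(** Descending, because the sieve below picks the prime factors of a divisor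
    from the largest to the smallest. *)
Definition primes_desc (n : nat) : seq nat :=
  rev [seq q <- iota 0 n.+1 | prime q].

Lemma mem_primes_desc n q : (q \in primes_desc n) = prime q && (q <= n)%N.
Proof. by rewrite mem_rev mem_filter mem_iota add0n ltnS. Qed.

Lemma primes_desc_uniq n : uniq (primes_desc n).
Proof. by rewrite rev_uniq filter_uniq ?iota_uniq. Qed.

Lemma primes_desc_sorted n : sorted gtn (primes_desc n).
Proof.
rewrite rev_sorted; apply: sorted_filter; last exact: iota_ltn_sorted.
by move=> a b c; apply: ltn_trans.
Qed.

Lemma big_primes_desc (T : Type) (idx : T) (op : Monoid.com_law idx)
    (F : nat -> T) n :
  \big[op/idx]_(q <- primes_desc n) F q =
  \big[op/idx]_(0 <= q < n.+1 | prime q) F q.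
Proof.
rewrite -[RHS]big_filter /index_iota subn0; apply: perm_big.
by rewrite /primes_desc perm_rev.
Qed.

Lemma fact_le_expn n : (n`! <= n ^ n)%N.
Proof.
rewrite fact_prod (@leq_trans (\prod_(1 <= i < n.+1) n)%N) //.
  rewrite big_nat_cond [X in (_ <= X)%N]big_nat_cond.
  by apply: leq_prod => i /andP[/andP[_]]; rewrite ltnS.
by rewrite prod_nat_const_nat subn1.
Qed.

Lemma prod_prime_powers_dvdn (l : seq nat) (f : nat -> nat) (m : nat) :
  uniq l -> all prime l -> (forall q, q \in l -> q ^ f q %| m)%N ->
  (\prod_(q <- l) q ^ f q %| m)%N.
Proof.
elim: l => [|q l IHl] /=; first by rewrite big_nil dvd1n.
move=> /andP[qNl ul] /andP[pq pl] lm; rewrite big_cons Gauss_dvd.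
  rewrite lm ?mem_head //= IHl // => r rl.
  by rewrite lm // inE rl orbT.
rewrite big_seq; elim/big_rec: _ => [|r z rl cz]; first exact: coprimen1.
rewrite coprimeMr cz andbT coprimeXl // coprimeXr //.
have pr : prime r := allP pl _ rl.
by rewrite prime_coprime // dvdn_prime2 //; apply: contra qNl => /eqP ->.
Qed.

(** Every prime [q <= n] divides [n!] at least [n %/ q >= n / (2 q)] times, and
    [n! <= n ^ n].  This bound of Mertens type is off by a factor 2, which the
    sieve can afford. *)
Lemma sum_ln_primes_le (R : realType) (n : nat) : (0 < n)%N ->
  \sum_(q <- primes_desc n) ln (q%:R : R) / q%:R <= 2 * ln n%:R.
Proof.
move=> n0.
have prime_l q : q \in primes_desc n -> prime q /\ (q <= n)%N.
  by rewrite mem_primes_desc => /andP.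
have /dvdn_leq : (\prod_(q <- primes_desc n) q ^ (n %/ q) %| n`!)%N.
  apply: prod_prime_powers_dvdn; first exact: primes_desc_uniq.
    by apply/allP => q /prime_l[].
  move=> q /prime_l[pq qn]; rewrite pfactor_dvdn ?fact_gt0 // logn_fact //.
  by rewrite big_ltn ?ltnS // expn1 leq_addr.
rewrite fact_gt0 => /(_ isT) le_fact.
have ineq : \sum_(q <- primes_desc n) (n%:R / (2 * q%:R)) * ln (q%:R : R)
    <= ln (n`!%:R : R).
  rewrite (@le_trans _ _
      (ln ((\prod_(q <- primes_desc n) q ^ (n %/ q))%N%:R : R))) //; last first.
    rewrite ler_ln ?ler_nat ?posrE ?ltr0n ?fact_gt0 //.
    rewrite big_seq prodn_cond_gt0 // => q /prime_l[pq _].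
    by rewrite expn_gt0 prime_gt0.
  rewrite natr_prod big_seq [X in _ <= ln X]big_seq.
  suff [] : \sum_(q <- primes_desc n | q \in primes_desc n)
       (n%:R / (2 * q%:R)) * ln (q%:R : R) <=
    ln (\prod_(q <- primes_desc n | q \in primes_desc n) (q ^ (n %/ q))%:R : R)
    /\ 0 < \prod_(q <- primes_desc n | q \in primes_desc n)
           (q ^ (n %/ q))%:R :> R by [].
  elim/big_rec2: _ => [|q a b /prime_l[pq qn] [ab a0]]; first by rewrite ln1.
  have q0 : 0 < q%:R :> R by rewrite ltr0n prime_gt0.
  have qq0 : 0 < (q ^ (n %/ q))%:R :> R by rewrite ltr0n expn_gt0 prime_gt0.
  split; last exact: mulr_gt0.
  rewrite lnM ?posrE // lerD // natrX lnXn // -[_ *+ (_ %/ _)]mulr_natl ler_wpM2r //.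
    by rewrite ln_ge0 // ler1n prime_gt0.
  rewrite ler_pdivrMr ?mulr_gt0 // -!natrM ler_nat.
  have := ltn_ceil n (prime_gt0 pq); rewrite mulSn => lt1.
  have : (q <= n %/ q * q)%N.
    by rewrite -{1}[q]mul1n leq_mul2r divn_gt0 ?prime_gt0 // qn orbT.
  lia.
have : ln (n`!%:R : R) <= n%:R * ln n%:R.
  rewrite mulr_natl -lnXn ?ltr0n //.
  by rewrite ler_ln ?posrE -?natrX ?ltr0n ?fact_gt0 ?expn_gt0 ?n0 // ler_nat
    fact_le_expn.
move=> /(le_trans ineq).
have -> : \sum_(q <- primes_desc n) (n%:R / (2 * q%:R)) * ln (q%:R : R) =
   n%:R / 2 * (\sum_(q <- primes_desc n) ln (q%:R : R) / q%:R).
  rewrite mulr_sumr; apply: eq_bigr => q _.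
  by rewrite invfM; ring.
have nR : 0 < n%:R :> R by rewrite ltr0n.
rewrite -mulrA ler_pM2l // => H; lra.
Qed.

Lemma ler_sum_uniq_sub (R : realType) (T : eqType) (s t : seq T) (F : T -> R) :
  uniq s -> {subset s <= t} -> (forall i, i \in t -> 0 <= F i) ->
  \sum_(i <- s) F i <= \sum_(i <- t) F i.
Proof.
elim: s t => [|a s IHs] t /=.
  by move=> _ _ F0; rewrite big_nil big_seq sumr_ge0.
move=> /andP[aNs us] st F0; have at_ : a \in t by rewrite st ?mem_head.
rewrite (perm_big _ (perm_to_rem at_)) !big_cons lerD2l IHs //.
  move=> i is_; have := st i; rewrite inE is_ orbT => /(_ isT) it.
  have := perm_mem (perm_to_rem at_) i; rewrite it inE => /esym/orP[/eqP ia|//].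
  by rewrite -ia is_ in aNs.
by move=> i /mem_rem /F0.
Qed.

Lemma sum_ln_primes_leR (R : realType) (n : nat) (z : R) : 1 <= z ->
  \sum_(q <- primes_desc n | q%:R <= z) ln (q%:R : R) / q%:R <= 2 * ln z.
Proof.
move=> z1; set m := Num.truncn z.
have z0 : 0 <= z by rewrite (le_trans ler01).
have m0 : (0 < m)%N by rewrite truncn_gt0.
apply: (@le_trans _ _ (2 * ln m%:R)); last first.
  rewrite ler_pM2l // ler_ln ?posrE ?ltr0n ?(lt_le_trans ltr01) //.
  by rewrite truncn_le.
apply: le_trans (sum_ln_primes_le R m0).
rewrite -big_filter; apply: ler_sum_uniq_sub.
- by rewrite filter_uniq ?primes_desc_uniq.
- move=> q; rewrite mem_filter !mem_primes_desc => /and3P[qz -> _] /=.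
  by rewrite truncn_ge_nat.
- move=> q; rewrite mem_primes_desc => /andP[pq _].
  by rewrite divr_ge0 ?ln_ge0 ?ler1n ?prime_gt0.
Qed.

(** In logarithmic scale the primes between the [2^i]-th and the [2^i.+1]-th
    root of [n] have [ln q >= ln n / 2^i.+1], so the previous bound gives at most
    [4] for the sum of their inverses; there are [i] such ranges. *)
Lemma sum_inv_primes_le (R : realType) (n i : nat) : (0 < n)%N ->
  \sum_(q <- primes_desc n | (n < q ^ 2 ^ i)%N) (q%:R : R)^-1 <= 4 * i%:R.
Proof.
move=> n0; elim: i => [|i IHi].
  rewrite mulr0 big1_seq // => q /andP[]; rewrite expn0 expn1 mem_primes_desc.
  by rewrite ltnNge => /negbTE ->; rewrite andbF.
rewrite (bigID (fun q => n < q ^ 2 ^ i)%N) /=.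
rewrite -[i.+1%:R]natr1 mulrDr mulr1; apply: lerD.
  apply: le_trans IHi; rewrite big_mkcond [X in _ <= X]big_mkcond /=.
  rewrite big_seq [X in _ <= X]big_seq; apply: ler_sum => q.
  by case: ifP => [/andP[_ ->]//|_]; case: ifP.
case: (leqP n 1) => [n1|n1].
  rewrite big1_seq // => q; rewrite mem_primes_desc => /and3P[_ pq qn].
  by have := leq_trans (prime_gt1 pq) (leq_trans qn n1).
have lnn : 0 < ln n%:R :> R by rewrite ln_gt0 // ltr1n.
have p2 : 0 < 2 ^+ i :> R by rewrite exprn_gt0.
set z : R := expR (ln n%:R / 2 ^+ i).
have z1 : 1 <= z.
  by rewrite -expR0 ler_expR divr_ge0 // ltW.
have key := sum_ln_primes_leR n z1.
rewrite /z expRK in key.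
have {key} : 2 ^+ i.+1 / ln n%:R *
   (\sum_(q <- primes_desc n | q%:R <= z) ln (q%:R : R) / q%:R) <= 4.
  rewrite -[4](_ : 2 ^+ i.+1 / ln n%:R * (2 * (ln n%:R / 2 ^+ i)) = 4); last first.
    by rewrite exprS; field; rewrite !gt_eqF.
  by rewrite ler_pM2l // divr_gt0 ?exprn_gt0.
apply: le_trans; rewrite mulr_sumr big_mkcond [X in _ <= X]big_mkcond /=.
rewrite big_seq [X in _ <= X]big_seq; apply: ler_sum => q.
rewrite mem_primes_desc => /andP[pq qn].
have qn0 := prime_gt0 pq; have q0 : 0 < q%:R :> R by rewrite ltr0n.
have lnq : 0 <= ln q%:R :> R by rewrite ln_ge0 // ler1n prime_gt0.
case: ifP => [/andP[lo hi]|_]; last first.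
  by case: ifP => // _; rewrite mulr_ge0 // divr_ge0 // ltW.
have -> : q%:R <= z.
  rewrite -(lnK (x := q%:R)) ?posrE // /z ler_expR ler_pdivlMr //.
  rewrite mulrC -natrX mulr_natl -lnXn // ler_ln ?posrE ?exprn_gt0 ?ltr0n //.
  by rewrite -natrX ler_nat leqNgt.
have : ln n%:R <= 2 ^+ i.+1 * ln q%:R :> R.
  rewrite -natrX mulr_natl -lnXn // ler_ln ?posrE ?exprn_gt0 ?ltr0n //.
  by rewrite -natrX ler_nat ltnW.
move=> le; rewrite mulrA ler_peMl ?invr_ge0 ?(ltW q0) //.
by rewrite mulrAC ler_pdivlMr // mul1r.
Qed.

(** * Brun's sieve for a general truncation *)

Section BrunSieve.
Variable allowed : nat -> nat -> bool.

(** The divisors kept by the sieve, each given by the list of its prime factors.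
    The recursion describes the choices still to be made when [m] primes have
    been chosen; only choices of even rank are restricted, which is what makes
    the sieve a lower bound. *)
Fixpoint brun_support (l : seq nat) (m : nat) : seq (seq nat) :=
  if l is q :: l' then
    brun_support l' m ++
      (if odd m.+1 || allowed q m.+1
       then [seq q :: e | e <- brun_support l' m.+1] else [::])
  else [:: [::]].

Variable R : realType.

Definition brun_sum (g : nat -> R) (l : seq nat) (m : nat) : R :=
  \sum_(e <- brun_support l m) (-1) ^+ size e * \prod_(q <- e) g q.

Lemma brun_sum_nil g m : brun_sum g [::] m = 1.
Proof. by rewrite /brun_sum big_seq1 big_nil expr0 mulr1. Qed.

Lemma brun_sum_cons g q l m : brun_sum g (q :: l) m =
  brun_sum g l m -
  (if odd m.+1 || allowed q m.+1 then g q * brun_sum g l m.+1 else 0).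
Proof.
rewrite /brun_sum [brun_support _ _]/= big_cat /=; congr (_ + _).
case: ifP => _; last by rewrite big_nil oppr0.
rewrite big_map mulr_sumr -sumrN; apply: eq_bigr => e _.
by rewrite /= big_cons exprS; ring.
Qed.

(** Dropping a term of even rank removes a positive contribution, hence the
    truncation is a lower bound for the full product when [m] is even. After an
    odd number of choices the signs are reversed. *)
Lemma brun_sum_alternate g l m : (forall q, q \in l -> 0 <= g q <= 1) ->
  if odd m then \prod_(q <- l) (1 - g q) <= brun_sum g l m
  else brun_sum g l m <= \prod_(q <- l) (1 - g q).
Proof.
elim: l m => [|q l IHl] m g01; first by rewrite brun_sum_nil big_nil; case: odd.
have g01l r : r \in l -> 0 <= g r <= 1 by move=> rl; rewrite g01 // inE rl orbT.
have /andP[q0 q1] := g01 q (mem_head _ _).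
rewrite big_cons brun_sum_cons /=.
have V0 : 0 <= \prod_(r <- l) (1 - g r).
  by rewrite big_seq prodr_ge0 // => r /g01l /andP[_]; rewrite subr_ge0.
set V := \prod_(r <- l) _ in V0 *.
have := IHl m g01l; have := IHl m.+1 g01l; rewrite /= -/V.
case: (odd m) => /= H1 H2; last first.
  have : g q * V <= g q * brun_sum g l m.+1 by rewrite ler_wpM2l.
  move: H2; lra.
have : g q * brun_sum g l m.+1 <= g q * V by rewrite ler_wpM2l.
have : 0 <= g q * V by rewrite mulr_ge0.
case: ifP => _; move: H2; lra.
Qed.

(** The factor [1 + T * g q] is Rankin's weight for choosing [q] or not. A
    rejection at [p] leaves the product of [1 - g q] over [q < p] only; the factor
    [(1 - g q)^-1], for the primes from [p] on, allows to compare it with the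
    product over all of [l]. *)
Definition rejected_weight (g : nat -> R) (T : R) (l : seq nat) (k : nat) : R :=
  \prod_(q <- l | ~~ allowed q k) ((1 + T * g q) / (1 - g q)).

(** The truncation error is a sum over the first rejected choice. A rejection at
    rank [k] involves [k - m] chosen primes, all of them too large to be allowed
    at rank [k]; giving each of them the weight [T] and multiplying by
    [T ^- (k - m)] turns the sum into a product. The [- 1] records that at least
    one such prime exists; it makes the ranks without rejected primes
    disappear. *)
Lemma brun_sum_error g T l m n :
  (forall q, q \in l -> 0 <= g q < 1) -> 0 < T -> sorted gtn l ->
  (forall p q k, (q < p)%N -> allowed p k -> allowed q k) ->
  (m + size l <= n)%N ->
  `| brun_sum g l m - \prod_(q <- l) (1 - g q) | <=
  \prod_(q <- l) (1 - g q) *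
    \sum_(m <= k < n) T ^- (k.+1 - m) * (rejected_weight g T l k.+1 - 1).
Proof.
move=> g01 T0 + allowed_down.
elim: l m g01 => [|q l IHl] m g01 sl mn.
  rewrite brun_sum_nil big_nil subrr normr0 mul1r sumr_ge0 // => k _.
  by rewrite /rejected_weight big_nil subrr mulr0.
have g01l r : r \in l -> 0 <= g r < 1 by move=> rl; rewrite g01 // inE rl orbT.
have /andP[q0 q1] := g01 q (mem_head _ _).
have sl' : sorted gtn l by move: sl => /=; apply: path_sorted.
have V0 : 0 <= \prod_(r <- l) (1 - g r).
  by rewrite big_seq prodr_ge0 // => r /g01l /andP[_ /ltW]; rewrite subr_ge0.
rewrite big_cons brun_sum_cons.
set V := \prod_(r <- l) _ in V0 *.
have mn' : (m < n)%N by rewrite (leq_trans _ mn) // addnS ltnS leq_addr.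
pose W k := rejected_weight g T l k; pose W' k := rejected_weight g T (q :: l) k.
have W1 k : 1 <= W k.
  rewrite /W /rejected_weight big_seq_cond.
  elim/big_ind: _ => // [a b a1 b1|r /andP[/g01l /andP[r0 r1] _]].
    by rewrite -[1]mulr1 ler_pM.
  rewrite ler_pdivlMr ?subr_gt0 // mul1r.
  have : 0 <= T * g r by rewrite mulr_ge0 // ltW.
  lra.
have Tg0 : 0 <= T * g q by rewrite mulr_ge0 // ltW.
have W'E k : ~~ allowed q k ->
    (1 - g q) * (W' k - 1) = W k - 1 + T * g q * W k + g q.
  rewrite /W' /rejected_weight big_cons => ->.
  rewrite -/(rejected_weight g T l k) -/(W k).
  by field; rewrite subr_eq0 gt_eqF.
have step k : W k - 1 + T * g q * (W k - 1) <= (1 - g q) * (W' k - 1).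
  case: (boolP (allowed q k)) => aq.
    (* The list is decreasing, so no prime of it is rejected at rank [k]. *)
    have Wk : W k = 1.
      rewrite /W /rejected_weight big_seq_cond big_pred0 // => r.
      apply/negbTE/negP => /andP[rl]; rewrite (allowed_down q) //.
      have /allP := order_path_min (rev_trans ltn_trans) sl; exact.
    have -> : W' k = W k by rewrite /W' /rejected_weight big_cons aq.
    by rewrite Wk; lra.
  by rewrite W'E //; lra.
have := IHl m g01l sl' (leq_trans (leq_add (leqnn m) (leqnSn _)) mn).
have mn1 : (m.+1 + size l <= n)%N by rewrite addSnnS.
have := IHl m.+1 g01l sl' mn1; rewrite -/V.
rewrite [X in _ -> _ <= _ * X -> _]big_ltn // [X in _ -> _ -> _ <= _ * X]big_ltn //.
rewrite subSnn.
set S1 := \sum_(m.+1 <= k < n) T ^- (k.+1 - m.+1) * _.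
set S0 := \sum_(m.+1 <= k < n) T ^- (k.+1 - m) * (_ - 1).
set S' := \sum_(m.+1 <= k < n) T ^- (k.+1 - m) * (_ - 1).
rewrite -/(W m.+1) -/(W' m.+1) expr1 => H1 H0.
have SS : S0 + g q * S1 <= (1 - g q) * S'.
  rewrite !mulr_sumr -big_split /= big_seq [X in _ <= X]big_seq.
  apply: ler_sum => k; rewrite mem_index_iota => /andP[mk _].
  rewrite -/(W k.+1) -/(W' k.+1) subSn ?(ltnW mk) // subSS exprS.
  have iTk : 0 <= T^-1 / T ^+ (k - m).
    by rewrite divr_ge0 ?invr_ge0 ?exprn_ge0 // ltW.
  suff -> : (T * T ^+ (k - m))^-1 * (W k.+1 - 1) +
      g q * (T ^- (k - m) * (W k.+1 - 1)) =
      T^-1 / T ^+ (k - m) * (W k.+1 - 1 + T * g q * (W k.+1 - 1)).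
    by rewrite invfM mulrCA ler_wpM2l.
  by field; rewrite !(gt_eqF, exprn_gt0).
have S1_ge0 : 0 <= S1.
  rewrite /S1 sumr_ge0 // => k _; rewrite mulr_ge0 ?subr_ge0 ?W1 //.
  by rewrite invr_ge0 exprn_ge0 // ltW.
have iT : 0 < T^-1 by rewrite invr_gt0.
have gS1 : 0 <= g q * S1 by rewrite mulr_ge0.
have V_SS : V * (S0 + g q * S1) <= V * ((1 - g q) * S') by rewrite ler_wpM2l.
have W10 : 0 <= W m.+1 - 1 by rewrite subr_ge0.
have TW : 0 <= T * g q * (W m.+1 - 1) by rewrite mulr_ge0.
case: ifP => [_|/negbT].
  have V_step : V * (T^-1 * (W m.+1 - 1)) <= 
      V * (T^-1 * ((1 - g q) * (W' m.+1 - 1))).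
    rewrite ler_wpM2l // ler_pM2l //; have := step m.+1; lra.
  have -> : brun_sum g l m - g q * brun_sum g l m.+1 - (1 - g q) * V =
     (brun_sum g l m - V) - g q * (brun_sum g l m.+1 - V) by ring.
  apply: le_trans (ler_normB _ _) _; rewrite normrM (ger0_norm q0).
  have : g q * `|brun_sum g l m.+1 - V| <= g q * (V * S1) by rewrite ler_wpM2l.
  lra.
rewrite negb_or => /andP[_ aq]; rewrite subr0.
have V_step : V * (T^-1 * (W m.+1 - 1) + g q) <=
    V * (T^-1 * ((1 - g q) * (W' m.+1 - 1))).
  rewrite ler_wpM2l // W'E //.
  have -> : g q = T^-1 * (T * g q) by field; rewrite gt_eqF.
  rewrite -mulrDr ler_pM2l //.
  have -> : T^-1 * (T * g q) = g q by field; rewrite gt_eqF.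
  lra.
have -> : brun_sum g l m - (1 - g q) * V =
   (brun_sum g l m - V) + g q * V by ring.
apply: le_trans (ler_normD _ _) _; rewrite (ger0_norm (_ : 0 <= g q * V)) ?mulr_ge0 //.
have : 0 <= V * (g q * S1) by rewrite mulr_ge0.
lra.
Qed.
End BrunSieve.

(** * Truncation by halving *)

Section Support.
Variable allowed : nat -> nat -> bool.

Lemma brun_support_subseq l m e : e \in brun_support allowed l m -> subseq e l.
Proof.
elim: l m e => [|q l IHl] m e /=; first by rewrite inE => /eqP ->.
rewrite mem_cat => /orP[/IHl el|].
  exact: subseq_trans el (subseq_cons _ _).
case: ifP => // _ /mapP[e' /IHl el ->].
by rewrite /= eqxx.
Qed.

Lemma ler_sum_brun_support (R : realType) (f : seq nat -> R) l m m' :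
  (forall e, 0 <= f e) ->
  \sum_(e <- brun_support allowed l m) f e <=
  \sum_(e <- brun_support (fun _ _ => true) l m') f e.
Proof.
elim: l m m' f => [|q l IHl] m m' f f0 /=; first by rewrite !big_seq1.
rewrite orbT !big_cat /= lerD ?IHl //; case: ifP => _.
  by rewrite !big_map IHl // => e.
by rewrite big_nil big_map sumr_ge0.
Qed.
End Support.

(** Among the products of subsets of [l], those dividing [a] only use the
    elements of [l] that divide [a]. *)
Lemma count_dvd_subsets (R : realType) (l : seq nat) (m a : nat) :
  \sum_(e <- brun_support (fun _ _ => true) l m) ((\prod_(q <- e) q %| a)%N)%:R
    <= 2 ^+ count (fun q => q %| a)%N l :> R.
Proof.
elim: l m => [|q l IHl] m /=; first by rewrite big_seq1 big_nil dvd1n.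
rewrite orbT big_cat big_map /=; case: (boolP (q %| a)%N) => qa.
  rewrite exprD expr1 mulr_natl mulr2n lerD ?IHl //.
  apply: le_trans (IHl m.+1); apply: ler_sum => e _; rewrite big_cons.
  case: (boolP (_ * _ %| a)%N) => [/(dvdn_trans (dvdn_mull _ (dvdnn _))) ->//|_].
  by rewrite ler0n.
rewrite add0n [X in _ + X]big1 ?addr0 ?IHl // => e _.
rewrite big_cons; case: (boolP (_ * _ %| a)%N) => // /(dvdn_trans (dvdn_mulr _ (dvdnn _))).
by rewrite (negbTE qa).
Qed.

Lemma fact_le_prod_sorted (s : seq nat) :
  sorted gtn s -> all (leq 1) s -> ((size s)`! <= \prod_(q <- s) q)%N.
Proof.
suff H : forall s, sorted gtn s -> all (leq 1) s ->
  ((size s)`! <= \prod_(q <- s) q)%N /\ (size s <= head 0 s)%N.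
  by move=> ss s1; case: (H s ss s1).
elim=> [|a {}s IHs] /=; first by rewrite big_nil.
move=> ps /andP[a1 s1]; have [fs hs] := IHs (path_sorted ps) s1.
have lt : (size s < a)%N.
  case: s ps hs {IHs fs s1} => [|b s] //= /andP[ba _] hb.
  exact: leq_ltn_trans hb ba.
by split => //; rewrite big_cons factS leq_mul.
Qed.

Section BrunParameters.
(** In logarithmic scale, after [b] unrestricted choices the largest prime that
    may be chosen is halved every [B] choices. The subtraction is truncated, so
    that all primes up to [Y] are allowed at ranks below [b + B]. *)
Definition brun_allowed (Y b B q k : nat) : bool :=
  (q ^ 2 ^ ((k - b) %/ B) <= Y)%N.

Lemma brun_allowed_down Y b B p q k : (q < p)%N ->
  brun_allowed Y b B p k -> brun_allowed Y b B q k.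
Proof.
by move=> qp; apply: leq_trans; rewrite leq_exp2r ?expn_gt0 // ltnW.
Qed.

Variable R : realType.

Lemma halving_sum (b B r : nat) : (0 < B)%N ->
  \sum_(0 <= k < r) (2 ^- ((k - b) %/ B) : R) <= b%:R + 2 * B%:R.
Proof.
move=> B0.
have block s : \sum_(0 <= k < s * B) (2 ^- (k %/ B) : R) = 
    B%:R * (2 - 2 * 2 ^- s).
  elim: s => [|s IHs]; first by rewrite mul0n big_geq // expr0 invr1; ring.
  rewrite (@big_cat_nat _ _ _ (s * B)) //= ?IHs ?leq_mul2r ?leqnSn ?orbT //.
  rewrite (eq_big_nat _ _ (F2 := fun=> 2 ^- s)); last first.
    move=> k /andP[lo hi]; congr (_ ^- _); apply/eqP.
    by rewrite eqn_leq -ltnS ltn_divLR // hi leq_divRL.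
  rewrite big_const_nat iter_addr_0 mulSn addnK -mulr_natl exprS.
  by field; rewrite expf_neq0.
have tail s : \sum_(0 <= k < s) (2 ^- (k %/ B) : R) <= 2 * B%:R.
  apply: (@le_trans _ _ (\sum_(0 <= k < s * B) (2 ^- (k %/ B) : R))).
    rewrite [X in _ <= X](@big_cat_nat _ _ _ s) ?leq_pmulr //= lerDl.
    by rewrite sumr_ge0 // => k _; rewrite invr_ge0 exprn_ge0.
  have s0 : 0 <= 2 ^- s :> R by rewrite invr_ge0 exprn_ge0.
  have : 0 <= B%:R * 2 ^- s :> R by rewrite mulr_ge0.
  by rewrite block; lra.
case: (leqP r b) => rb.
  rewrite (@le_trans _ _ (\sum_(0 <= k < r) 1)) //.
    apply: ler_sum => k _; rewrite invf_le1 ?exprn_gt0 // exprn_ege1 //.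
    by rewrite ler1n.
  rewrite big_const_nat iter_addr_0 subn0 -[_ *+ _]mulr_natl mulr1.
  by rewrite (@le_trans _ _ b%:R) ?ler_nat // lerDl mulr_ge0.
rewrite (@big_cat_nat _ _ _ b) //=; last exact: ltnW.
apply: lerD.
  rewrite big_nat_cond (eq_bigr (fun=> 1)) -?big_nat_cond.
    by rewrite big_const_nat iter_addr_0 subn0.
  move=> k /andP[/andP[_ kb] _].
  by rewrite (eqP (ltnW kb : (k - b == 0)%N)) div0n expr0 invr1.
rewrite -{1}[b]add0n big_addn.
by rewrite (eq_bigr (fun k => 2 ^- (k %/ B))) // => k _; rewrite addnK.
Qed.

(** The [k]-th chosen prime [q] satisfies [ln q <= 2 ^- ((k.-1 - b) %/ B) * ln Y]:
    for even [k] because it was allowed, for odd [k] because it is smaller than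
    the previous one. The second case is why the hypothesis on [l] is needed when
    [m] is even: it records what the previous choice has imposed on [l]. *)
Lemma ln_brun_support_le (Y b B : nat) (l e : seq nat) (m : nat) :
  (0 < Y)%N -> sorted gtn l -> all (leq 1) l ->
  (~~ odd m -> all (fun q => q ^ 2 ^ ((m - b) %/ B) <= Y)%N l) ->
  e \in brun_support (brun_allowed Y b B) l m ->
  ln ((\prod_(q <- e) q)%N%:R : R) <=
  ln Y%:R * \sum_(m <= k < m + size e) 2 ^- ((k - b) %/ B).
Proof.
move=> Y0; elim: l m e => [|q l IHl] m e.
  by rewrite /= inE => _ _ _ /eqP ->; rewrite big_nil ln1 addn0 big_geq ?mulr0.
move=> sl /= /andP[q1 l1] inv.
have sl' := path_sorted sl.
rewrite mem_cat => /orP[eIn|].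
  by apply: (IHl m) => // mN; have /andP[] := inv mN.
case: ifP => // allowedE /mapP[e' e'In ->].
have qY : (q ^ 2 ^ ((m - b) %/ B) <= Y)%N.
  move: allowedE; rewrite /= /brun_allowed; case: (boolP (odd m)) => om /=.
    apply: leq_trans; rewrite leq_pexp2l ?leq_pexp2l //.
    by rewrite leq_div2r // leq_sub2r.
  by move=> _; have /andP[] := inv om.
have lnq : ln (q%:R : R) <= ln Y%:R * 2 ^- ((m - b) %/ B).
  rewrite ler_pdivlMr ?exprn_gt0 // mulrC -natrX mulr_natl -lnXn ?ltr0n //.
  by rewrite ler_ln ?posrE ?exprn_gt0 ?ltr0n // -natrX ler_nat.
rewrite big_cons natrM lnM ?posrE ?ltr0n //; last first.
  rewrite big_seq prodn_cond_gt0 // => r /(mem_subseq (brun_support_subseq e'In)).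
  by move/(allP l1).
rewrite /= addnS big_ltn ?ltnS ?leq_addr // mulrDr lerD // -addSn.
apply: IHl => //= /negPn om; apply/allP => r rl.
move: allowedE; rewrite /= om /= => /brun_allowed_down; apply.
by have /allP := order_path_min (rev_trans ltn_trans) sl; apply.
Qed.

(** The halving makes the room used after the first [b] choices a geometric
    series, of total [2 * B]. *)
Lemma prod_brun_support_le (Y b B : nat) (e : seq nat) :
  (0 < Y)%N -> (0 < B)%N ->
  e \in brun_support (brun_allowed Y b B) (primes_desc Y) 0 ->
  ln ((\prod_(q <- e) q)%N%:R : R) <= (b%:R + 2 * B%:R) * ln Y%:R.
Proof.
move=> Y0 B0 eIn.
have l1 : all (leq 1) (primes_desc Y).
  by apply/allP => q; rewrite mem_primes_desc => /andP[/prime_gt0].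
have := ln_brun_support_le Y0 (primes_desc_sorted Y) l1 _ eIn.
rewrite add0n mulrC => /(_ _)/le_trans; apply.
  move=> _; apply/allP => q; rewrite mem_primes_desc sub0n div0n expn0 expn1.
  by case/andP.
by rewrite ler_wpM2r ?halving_sum // ln_ge0 // ler1n.
Qed.

(** The first rejected choice has rank [k > b] and is one of the primes between
    the [2 ^ ((k - b) %/ B)]-th root of [Y] and [Y]. These have inverses summing
    to at most [4 * (k - b) / B], so for [B] large the Rankin weight [T ^- k]
    beats the weight of the rejected primes. *)
Lemma brun_density (Y b B : nat) (T : R) : (0 < Y)%N ->
  4^-1 <= ln T -> 32 * (T + 2) <= B%:R ->
  \prod_(q <- primes_desc Y) (1 - q%:R^-1) * (1 - 8 * T ^- b) <=
  brun_sum (brun_allowed Y b B) (fun q => q%:R^-1 : R) (primes_desc Y) 0.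
Proof.
move=> Y0 lnT BT.
have T0 : 0 < T by rewrite ltNge; apply/negP => /ln0 lnT0; move: lnT; rewrite lnT0; lra.
have T1 : 1 <= T.
  rewrite -ler_ln ?posrE // ln1; lra.
have B0 : 0 < B%:R :> R by lra.
set l := primes_desc Y; set g : nat -> R := fun q => q%:R^-1.
have gl q : q \in l -> 0 < g q /\ g q <= 2^-1.
  rewrite mem_primes_desc => /andP[pq _].
  by rewrite /g invr_gt0 ltr0n prime_gt0 // lef_pV2 ?posrE ?ltr0n ?prime_gt0 //
    ler_nat prime_gt1.
have g01 q : q \in l -> 0 <= g q < 1 by move=> /gl []; lra.
have := brun_sum_error g01 T0 (primes_desc_sorted Y) (@brun_allowed_down Y b B)
  (leqnn (0 + size l)).
set V := \prod_(q <- l) _.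
have V0 : 0 <= V.
  by rewrite /V big_seq prodr_ge0 // => q /g01 /andP[_ /ltW]; rewrite subr_ge0.
move: (0 + size l)%N => n.
suff sum_le : \sum_(0 <= k < n) T ^- (k.+1 - 0) *
   (rejected_weight (brun_allowed Y b B) g T l k.+1 - 1) <= 8 * T ^- b.
  rewrite ler_norml => /andP[lo _].
  have := ler_wpM2l V0 sum_le; move: lo; lra.
(* Ranks up to [b] reject nothing, and rank [b + j] contributes at most
   [T ^- b * r ^ j] with this ratio. *)
pose r : R := expR (- 8^-1).
have r0 : 0 < r by exact: expR_gt0.
have r89 : r <= 8 / 9.
  have := expRxMexpNx_1 (8^-1 : R); have := expR_ge1Dx (8^-1 : R).
  rewrite -/r => e8; have := ler_wpM2r (ltW r0) e8; lra.
have term k : T ^- (k.+1 - 0) *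
   (rejected_weight (brun_allowed Y b B) g T l k.+1 - 1) <=
   T ^- b * (if (k < b)%N then 0 else r ^+ (k.+1 - b)).
  have weight_le : rejected_weight (brun_allowed Y b B) g T l k.+1 <=
      expR ((T + 2) * (4 * ((k.+1 - b) %/ B)%:R)).
    apply: (@le_trans _ _ (expR ((T + 2) *
       \sum_(q <- l | ~~ brun_allowed Y b B q k.+1) g q))); last first.
      rewrite ler_expR ler_wpM2l //; first lra.
      have := sum_inv_primes_le R ((k.+1 - b) %/ B) Y0; apply: le_trans.
      by rewrite le_eqVlt; apply/orP; left; apply/eqP; apply: eq_bigl => q; rewrite /brun_allowed ltnNge.
    rewrite mulr_sumr expR_sum /rejected_weight big_seq_cond [X in _ <= X]big_seq_cond.
    apply: ler_prod => q /andP[/gl [g0 g2] _].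
    have Tg : 0 <= T * g q by rewrite mulr_ge0 // ltW.
    have g1 : 0 < 1 - g q by lra.
    rewrite divr_ge0 ?(ltW g1) ?addr_ge0 //= ler_pdivrMr //.
    (* As [g q <= 1/2], the Euler factor is at most [exp (2 * g q)]. *)
    rewrite mulrDl expRD -mulrA.
    have e1 := expR_ge1Dx (T * g q).
    suff : 1 <= expR (2 * g q) * (1 - g q).
      by move=> e2; rewrite (le_trans e1) // ler_peMr ?expR_ge0.
    have e2 := expR_ge1Dx (2 * g q).
    have : (1 + 2 * g q) * (1 - g q) <= expR (2 * g q) * (1 - g q).
      by rewrite ler_wpM2r // ltW.
    nra.
  case: (ltnP k b) => kb.
    rewrite mulr0 mulr_ge0_le0 ?invr_ge0 ?exprn_ge0 ?(ltW T0) // subr_le0.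
    apply: le_trans weight_le _.
    by rewrite (eqP (kb : (k.+1 - b == 0)%N)) div0n mulr0 mulr0 expR0.
  set j := (k.+1 - b)%N in weight_le *.
  have kE : k.+1 = (b + j)%N by rewrite /j subnKC // ltnW.
  rewrite subn0 {1}kE exprD invfM -mulrA ler_pM2l ?invr_gt0 ?exprn_gt0 //.
  apply: (@le_trans _ _ (T ^- j * expR ((T + 2) * (4 * (j %/ B)%:R)))).
    by rewrite ler_pM2l ?invr_gt0 ?exprn_gt0 //; lra.
  rewrite -{1}(lnK (x := T)) ?posrE // -expRM_natl -expRN -expRD /r -expRM_natl.
  rewrite ler_expR.
  have jB : (j %/ B)%:R * B%:R <= j%:R :> R by rewrite -natrM ler_nat leq_trunc_div.
  have j0 : 0 <= j%:R :> R by [].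
  have d0 : 0 <= (j %/ B)%:R :> R by [].
  move: (j %/ B)%:R (j%:R) jB j0 d0 => D J DJ J0 D0.
  have : 32 * (T + 2) * D <= J by nra.
  have : J * 4^-1 <= J * ln T by rewrite ler_wpM2l.
  nra.
apply: le_trans (ler_sum _ (fun k _ => term k)) _.
rewrite -mulr_sumr mulrC ler_wpM2r ?invr_ge0 ?exprn_ge0 ?(ltW T0) //.
suff : \sum_(0 <= k < n) (if (k < b)%N then 0 else r ^+ (k.+1 - b)) <=
    8 * (1 - r ^+ (n - b)).
  by have := exprn_ge0 (n - b) (ltW r0); lra.
elim: n => [|n IHn]; first by rewrite big_geq // sub0n expr0; lra.
rewrite big_nat_recr //=; case: (ltnP n b) => nb.
  by move: IHn; rewrite (eqP (ltnW nb : (n - b == 0)%N)) (eqP (nb : (n.+1 - b == 0)%N)) addr0.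
move: IHn; rewrite subSn // exprS.
have : 0 <= r ^+ (n - b) by rewrite exprn_ge0 // ltW.
nra.
Qed.
End BrunParameters.

(** * Prime divisor counts and the Rankin moment *)

(** If [k! <= x] then [r ^ k <= k! * exp r <= x * exp r] for all [r >= 0]. The
    choice [r = (ln x) ^ (7/8)] gives [k <= (8/7 + o(1)) ln x / ln (ln x)], where
    the constant is at most [4/3] as soon as [6 ^ 8 <= ln x]; and
    [ln 2 <= 3/4]. *)
Lemma two_expn_le_loglog_factor (R : realType) (x : R) (k : nat) :
  6 ^+ 8 <= ln x -> (k`!)%:R <= x -> 2 ^+ k <= loglog_factor x.
Proof.
move=> Lx kx; set L := ln x in Lx; set l := ln L.
have L0 : 0 < L by rewrite (lt_le_trans _ Lx) // exprn_gt0.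
have x0 : 0 < x by rewrite (lt_le_trans _ kx) // ltr0n fact_gt0.
have l0 : 0 < l.
  by rewrite ln_gt0 // (lt_le_trans _ Lx) // exprn_egt1 // ltr1n.
(* [s ^ 8 = ln x], and the parameter [r] above is [s ^ 7]. *)
set s := expR (l / 8).
have s0 : 0 < s by exact: expR_gt0.
have sL : s ^+ 8 = L.
  by rewrite /s -expRM_natl mulrC divfK // lnK.
have s6 : 6 <= s.
  by rewrite -(ler_pXn2r (n := 8)) ?nnegrE ?(ltW s0) // sL.
have ln2 : ln 2 <= 3 / 4 :> R.
  rewrite -ler_expR lnK ?posrE //.
  (* The eighth power makes the linear lower bound of the exponential precise
     enough. *)
  have -> : 3 / 4 = 8%:R * (3 / 32) :> R by field.
  rewrite expRM_natl; apply: (@le_trans _ _ ((1 + 3 / 32) ^+ 8)); first lra.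
  by rewrite lerXn2r ?nnegrE ?expR_ge0 ?expR_ge1Dx //; lra.
rewrite /loglog_factor /powR gt_eqF // -/L -/l.
rewrite -[2](@lnK R) ?posrE // -expRM_natl ler_expR mulrC.
rewrite ler_pdivlMl //.
suff kl : k%:R * (7 / 8 * l) <= 7 / 6 * L.
  have : 0 <= k%:R * l by rewrite mulr_ge0 // ltW.
  nra.
case: k kx => [|k] kx; first by rewrite mul0r mulr_ge0 ?divr_ge0 // ltW.
have r0 : 0 < s ^+ 7 by rewrite exprn_gt0.
have kr : s ^+ 7 ^+ k.+1 <= x * expR (s ^+ 7).
  have fk : 0 < (k.+1)`!%:R :> R by rewrite ltr0n fact_gt0.
  have := expR_ge1Dxn k (ltW r0); move=> /(le_trans (ltW (ltr_pwDl ltr01 (lexx _)))).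
  rewrite ler_pdivrMr // => /le_trans; apply; rewrite mulrC.
  by rewrite ler_wpM2r ?expR_ge0.
have : ln (s ^+ 7 ^+ k.+1) <= ln (x * expR (s ^+ 7)).
  by rewrite ler_ln ?posrE ?mulr_gt0 ?expR_gt0 ?exprn_gt0.
rewrite lnM ?posrE ?expR_gt0 // expRK -/L !lnXn ?exprn_gt0 //.
have -> : ln s = l / 8 by rewrite /s expRK.
have -> : l / 8 *+ 7 *+ k.+1 = k.+1%:R * (7 / 8 * l).
  by rewrite -mulr_natl -[_ *+ 7]mulr_natl; field.
move/le_trans; apply; rewrite -sL exprS.
by have := ler_wpM2r (ltW r0) s6; lra.
Qed.

(** A product of [k] distinct primes is at least [k!]. *)
Lemma two_expn_count_primes (R : realType) (x : R) (n a : nat) :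
  6 ^+ 8 <= ln x -> (0 < a)%N -> a%:R <= x ->
  2 ^+ count (fun q => q %| a)%N (primes_desc n) <= loglog_factor x.
Proof.
move=> Lx a0 ax; apply: two_expn_le_loglog_factor => //.
apply: le_trans ax; rewrite ler_nat -size_filter.
set s := [seq q <- _ | _].
have sP q : q \in s -> (q %| a)%N /\ prime q.
  by rewrite mem_filter mem_primes_desc => /and3P[].
apply: leq_trans (fact_le_prod_sorted _ _) _.
- by apply: sorted_filter (primes_desc_sorted n); exact: rev_trans ltn_trans.
- by apply/allP => q /sP[_ /prime_gt0].
apply: dvdn_leq => //.
rewrite (eq_bigr (fun q => q ^ 1)%N) => [|q _]; last by rewrite expn1.
apply: prod_prime_powers_dvdn; first by rewrite filter_uniq ?primes_desc_uniq.
  by apply/allP => q /sP[].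
by move=> q /sP[qa _]; rewrite expn1.
Qed.

(** Rankin's bound for the moment of order [alpha] of [\prod_p p ^ Geom_p]: an
    Euler product whose logarithm is a multiple of [\sum_p ln p / p]. *)
Lemma euler_product_moment (R : realType) (Y : nat) (y eta T : R) :
  (0 < Y)%N -> Y%:R <= y -> 0 < eta -> 1 <= T -> 1 < y ->
  ln T <= (1 - eta) * ln y ->
  \prod_(q <- primes_desc Y)
     ((1 - q%:R^-1) / (1 - expR (ln T / ln y * ln q%:R) / q%:R)) <=
  expR (2 / (1 - expR (- eta * ln 2)) * (T * ln T)).
Proof.
move=> Y0 Yy eta0 T1 y1 Ty; set c := 1 - _.
have lny : 0 < ln y by rewrite ln_gt0.
have lnT : 0 <= ln T by rewrite ln_ge0.
have T0 : 0 < T by rewrite (lt_le_trans ltr01).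
set alpha := ln T / ln y.
have alpha0 : 0 <= alpha by rewrite divr_ge0 // ltW.
have alpha1 : alpha <= 1 - eta by rewrite ler_pdivrMr.
have ln2 : 0 < ln 2 :> R by rewrite ln_gt0 // ltr1n.
have c0 : 0 < c.
  by rewrite subr_gt0 expR_lt1 mulNr oppr_lt0 mulr_gt0.
have aTc0 : 0 <= alpha * T / c.
  by apply: divr_ge0; [apply: mulr_ge0 => //|]; exact: ltW.
apply: (@le_trans _ _ (expR (\sum_(q <- primes_desc Y)
   alpha * T / c * (ln q%:R / q%:R)))); last first.
  rewrite ler_expR -mulr_sumr.
  apply: (@le_trans _ _ (alpha * T / c * (2 * ln Y%:R))).
    by rewrite ler_wpM2l ?sum_ln_primes_le.
  have Yln : ln Y%:R <= ln y.
    by rewrite ler_ln ?posrE ?ltr0n // (lt_trans ltr01).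
  apply: (@le_trans _ _ (alpha * T / c * (2 * ln y))).
    by rewrite ler_wpM2l ?ler_pM2l.
  by rewrite le_eqVlt; apply/orP; left; apply/eqP; rewrite /alpha; field; rewrite !gt_eqF.
rewrite expR_sum big_seq [X in _ <= X]big_seq; apply: ler_prod => q.
rewrite mem_primes_desc => /andP[pq qY].
have q0 : 0 < q%:R :> R by rewrite ltr0n prime_gt0.
have q2 : 2 <= q%:R :> R by rewrite ler_nat prime_gt1.
have lnq2 : ln 2 <= ln q%:R :> R by rewrite ler_ln ?posrE.
have lnqy : ln q%:R <= ln y :> R.
  rewrite ler_ln ?posrE // ?(lt_trans ltr01) // (le_trans _ Yy) // ler_nat //.
set E := expR (alpha * ln q%:R).
have E0 : 0 < E by exact: expR_gt0.
have ET : E <= T.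
  rewrite /E -[X in _ <= X](@lnK R) ?posrE // ler_expR /alpha.
  rewrite mulrAC ler_pdivrMr // ler_wpM2l //.
have rho : E / q%:R <= 1 - c.
  rewrite /c opprB addrC subrK.
  rewrite -{1}(@lnK R q%:R) ?posrE // -expRN /E -expRD ler_expR.
  have : (1 - eta) * ln q%:R <= (1 - eta) * ln q%:R by [].
  have : alpha * ln q%:R <= (1 - eta) * ln q%:R by rewrite ler_wpM2r //; lra.
  have : eta * ln 2 <= eta * ln q%:R by rewrite ler_pM2l.
  lra.
have d0 : 0 < 1 - E / q%:R by lra.
have iq : 0 < q%:R^-1 :> R by rewrite invr_gt0.
have iq1 : q%:R^-1 <= 1 :> R by rewrite invf_le1 //; lra.
rewrite divr_ge0 ?(ltW d0) ?subr_ge0 //=.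
have E1 : E - 1 <= alpha * T * ln q%:R.
  have := expR_ge1Dx (- (alpha * ln q%:R)); rewrite expRN -/E => H.
  have : E * (1 - alpha * ln q%:R) <= 1 by rewrite -ler_pdivlMl // mulr1.
  have : E * (alpha * ln q%:R) <= T * (alpha * ln q%:R).
    by rewrite ler_wpM2r // mulr_ge0 //; lra.
  lra.
have e1 := expR_ge1Dx (alpha * T / c * (ln q%:R / q%:R)).
apply: le_trans e1; rewrite ler_pdivrMr //.
have : (E - 1) / q%:R / c <= (alpha * T / c * (ln q%:R / q%:R)).
  have -> : alpha * T / c * (ln q%:R / q%:R) = alpha * T * ln q%:R / q%:R / c.
    by field; rewrite !gt_eqF.
  by rewrite !ler_pM2r ?invr_gt0.
set S := alpha * T / c * _.
rewrite ler_pdivrMr // => HS.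
have S0 : 0 <= S.
  by apply: mulr_ge0 => //; apply: divr_ge0; [lra|exact: ltW].
have : S * c <= S * (1 - E / q%:R) by rewrite ler_wpM2l //; lra.
move: HS; rewrite mulrBl mul1r; lra.
Qed.

(** * Smooth numbers and the pointwise sieve inequality *)

Section SmoothNumbers.
Variables (R : realType) (y : R).
Local Notation I := (prime_upto y).
Local Notation Y := (Num.truncn y).

Definition smooth_number (v : I -> nat) : nat := (\prod_(p : I) p ^ v p)%N.

Lemma prime_upto_prime (p : I) : prime p.
Proof. exact: valP p. Qed.

Lemma prime_upto_le (p : I) : (p <= Y)%N.
Proof. exact: ltn_ord (val p). Qed.

Lemma prime_upto_exists q : q \in primes_desc Y -> exists p : I, q = p.
Proof.
rewrite mem_primes_desc => /andP[pq qY].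
by exists (exist _ (Ordinal (qY : (q < Y.+1)%N)) pq : I).
Qed.

Lemma prime_val_inj : injective (@prime_val R y).
Proof. by move=> p q /val_inj /val_inj. Qed.

Lemma big_prime_upto (T : Type) (idx : T) (op : Monoid.com_law idx)
    (F : nat -> T) :
  \big[op/idx]_(p : I) F p = \big[op/idx]_(q <- primes_desc Y) F q.
Proof.
rewrite -(big_map (@prime_val R y) xpredT F); apply: perm_big.
apply: uniq_perm; rewrite ?primes_desc_uniq //.
  by rewrite map_inj_uniq ?index_enum_uniq //; exact: prime_val_inj.
move=> q; apply/mapP/idP => [[p _ ->]|/prime_upto_exists[p ->]].
  by rewrite mem_primes_desc prime_upto_prime prime_upto_le.
by exists p; rewrite ?mem_index_enum.
Qed.

Lemma smooth_number_gt0 v : (0 < smooth_number v)%N.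
Proof.
by rewrite /smooth_number prodn_gt0 // => p; rewrite expn_gt0 prime_gt0 ?prime_upto_prime.
Qed.

Lemma logn_smooth_number v (p : I) : logn p (smooth_number v) = v p.
Proof.
rewrite /smooth_number (bigD1 p) //= lognM; last 2 first.
- by rewrite expn_gt0 prime_gt0 ?prime_upto_prime.
- by rewrite prodn_cond_gt0 // => q _; rewrite expn_gt0 prime_gt0 ?prime_upto_prime.
rewrite pfactorK ?prime_upto_prime // logn_coprime ?addn0 //.
elim/big_ind: _ => [|a b|r rp]; first exact: coprimen1.
  by rewrite coprimeMr => -> ->.
rewrite coprimeXr // prime_coprime ?prime_upto_prime //.
rewrite dvdn_prime2 ?prime_upto_prime //.
by apply: contra rp => /eqP/prime_val_inj ->.
Qed.

Lemma prime_dvd_smooth_number v q :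
  prime q -> (q %| smooth_number v)%N -> (q <= Y)%N.
Proof.
move=> pq; rewrite Euclid_dvd_prod // big_orE => /existsP[/= p].
rewrite Euclid_dvdX // => /andP[+ _].
by rewrite dvdn_prime2 ?prime_upto_prime // => /eqP ->; exact: prime_upto_le.
Qed.

Lemma max_pdiv_le (n : nat) : 1 <= y -> (0 < n)%N ->
  (forall q, prime q -> (q %| n)%N -> (q <= Y)%N) -> (max_pdiv n)%:R <= y.
Proof.
move=> y1 n0 small; have y0 : 0 <= y by rewrite (le_trans ler01).
rewrite -truncn_ge_nat //; case: (leqP n 1) => n1.
  have -> : n = 1%N by lia.
  by rewrite truncn_gt0.
by apply: small; rewrite ?max_pdiv_prime ?max_pdiv_dvd.
Qed.

(** On the multiples [a = n * c] of [n = smooth_number v] the products [e] of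
    the sieve are tested on [c], and [a] has valuation vector [v] iff no prime
    up to [y] divides [c]. *)
Lemma sieve_pointwise (allowed : nat -> nat -> bool) (v : I -> nat) (a : nat) :
  (0 < a)%N ->
  \sum_(e <- brun_support allowed (primes_desc Y) 0)
     (-1) ^+ size e * ((smooth_number v * \prod_(q <- e) q %| a)%N)%:R <=
  [forall p : I, logn p a == v p]%:R :> R.
Proof.
move=> a0; set n := smooth_number v; have n0 : (0 < n)%N := smooth_number_gt0 v.
case: (boolP (n %| a)%N) => [/dvdnP[c ac]|nNa]; last first.
  rewrite big1 ?ler0n // => e _.
  case: (boolP (_ %| a)%N) => [/(dvdn_trans (dvdn_mulr _ (dvdnn _)))|_].
    by rewrite (negbTE nNa).
  by rewrite mulr0.
pose g q : R := (q %| c)%N%:R.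
have g01 q : q \in primes_desc Y -> 0 <= g q <= 1.
  by rewrite /g; case: (q %| c)%N; rewrite ?lexx ?ler01.
have -> : \sum_(e <- brun_support allowed (primes_desc Y) 0)
     (-1) ^+ size e * ((n * \prod_(q <- e) q %| a)%N)%:R =
     brun_sum allowed g (primes_desc Y) 0.
  apply: eq_big_seq => e eIn; congr (_ * _).
  rewrite ac mulnC dvdn_pmul2r //.
  have := brun_support_subseq eIn => sub.
  have ue : uniq e := subseq_uniq sub (primes_desc_uniq Y).
  have pe : all prime e.
    by apply/allP => q /(mem_subseq sub); rewrite mem_primes_desc => /andP[].
  have -> : (\prod_(q <- e) q %| c)%N = all (fun q => q %| c)%N e.
    apply/idP/allP => [dv q qe|dv].
      by apply: dvdn_trans dv; rewrite (perm_big _ (perm_to_rem qe)) big_cons dvdn_mulr.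
    rewrite (eq_bigr (fun q => q ^ 1)%N) => [|q _]; last by rewrite expn1.
    by apply: prod_prime_powers_dvdn => // q qe; rewrite expn1 dv.
  elim: (e) => [|q e' IHe]; first by rewrite big_nil.
  by rewrite big_cons /= -IHe /g; case: (q %| c)%N; rewrite ?mul1r ?mul0r.
have /= := brun_sum_alternate allowed 0 g01.
move/le_trans; apply.
case: (boolP [forall p : I, logn p a == v p]) => [_|].
  rewrite big_seq prodr_ile1 // => q /g01 /andP[? ?]; lra.
rewrite negb_forall => /existsP[p pv].
have pc : (prime_val p %| c)%N.
  apply: contraR pv => pNc; rewrite ac.
  have c0 : (0 < c)%N by move: a0; rewrite ac; case: (c).
  rewrite lognM // logn_smooth_number logn_coprime ?add0n //.
  by rewrite prime_coprime ?prime_upto_prime.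
have pIn : prime_val p \in primes_desc Y.
  by rewrite mem_primes_desc prime_upto_prime prime_upto_le.
have gp : g (prime_val p) = 1 by rewrite /g pc.
by rewrite (perm_big _ (perm_to_rem pIn)) big_cons gp subrr /= mul0r.
Qed.
End SmoothNumbers.

(** * Point masses and remainders *)

Section MainInequality.
Variables (R : realType) (y : R).
Local Notation I := (prime_upto y).
Local Notation Y := (Num.truncn y).

Local Notation euler_product := (\prod_(q <- primes_desc Y) (1 - q%:R^-1 : R)).

Lemma geometric_density (v : I -> nat) :
  \prod_(p : I) ((p%:R : R) ^- v p * (1 - p%:R^-1)) =
  (smooth_number v)%:R^-1 * euler_product.
Proof.
rewrite big_split /= (big_prime_upto y _ (fun q => 1 - q%:R^-1)); congr (_ * _).
rewrite /smooth_number natr_prod -prodfV.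
by apply: eq_bigr => p _; rewrite natrX.
Qed.

Lemma euler_product_ge0 : 0 <= euler_product.
Proof.
rewrite big_seq prodr_ge0 // => q; rewrite mem_primes_desc => /andP[pq _].
by rewrite subr_ge0 invf_le1 ?ltr0n ?ler1n prime_gt0.
Qed.

Section Box.
Variable M : nat.
Local Notation box := {ffun I -> 'I_M.+1}.
Local Notation number w := (smooth_number (fun p => nat_of_ord ((w : box) p))).

Lemma box_number_inj (w w' : box) : number w = number w' -> w = w'.
Proof.
move=> eq_ww'; apply/ffunP => p; apply/val_inj => /=.
by rewrite -[LHS](logn_smooth_number (fun p => w p)) eq_ww' logn_smooth_number.
Qed.

(** Writing [m = number w * \prod_(q <- e) q], the set [e] determines [w], and
    the number of possible sets [e] is at most [2 ^ omega(m)]. *)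
Lemma sum_sieve_remainders (Delta : nat -> R) (N Q : R) : 1 <= y -> 0 <= N ->
  (forall m, 0 <= Delta m) ->
  (forall m, (0 < m)%N -> m%:R <= N ->
     2 ^+ count (fun q => q %| m)%N (primes_desc Y) <= Q) ->
  \sum_(w : box) \sum_(e <- brun_support (fun _ _ => true) (primes_desc Y) 0)
    (if (number w * \prod_(q <- e) q)%N%:R <= N
     then Delta (number w * \prod_(q <- e) q)%N else 0) <=
  Q * \sum_(1 <= m < (Num.truncn N).+1 | (max_pdiv m)%:R <= y) Delta m.
Proof.
move=> y1 N0 D0 Qcount.
set supp := brun_support _ _ _.
pose mul w (e : seq nat) := (number w * \prod_(q <- e) q)%N.
have prod_gt0 e : e \in supp -> (0 < \prod_(q <- e) q)%N.
  move=> /brun_support_subseq/mem_subseq sub.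
  rewrite big_seq prodn_cond_gt0 // => q /sub; rewrite mem_primes_desc.
  by move=> /andP[/prime_gt0].
have mul_gt0 w e : e \in supp -> (0 < mul w e)%N.
  by move=> /prod_gt0 e0; rewrite muln_gt0 smooth_number_gt0 e0.
apply: (@le_trans _ _ (\sum_(w : box) \sum_(e <- supp)
    \sum_(1 <= m < (Num.truncn N).+1 | (max_pdiv m)%:R <= y)
      Delta m * (m == mul w e)%:R)).
  apply: ler_sum => w _; rewrite big_seq [X in _ <= X]big_seq.
  apply: ler_sum => e eIn; case: ifP => [le_N|_]; last first.
    by rewrite sumr_ge0 // => m _; rewrite mulr_ge0.
  rewrite -/(mul w e) in le_N *.
  rewrite -[X in _ <= X]big_filter (bigD1_seq (mul w e)) /=; last 2 first.
  - rewrite mem_filter mem_index_iota mul_gt0 //= ltnS truncn_ge_nat // le_N andbT.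
    apply: max_pdiv_le => //; first exact: mul_gt0.
    move=> q pq; rewrite /mul Euclid_dvdM // => /orP[|].
      exact: prime_dvd_smooth_number.
    rewrite Euclid_dvd_prod // big_has => /hasP[r re].
    have := mem_subseq (brun_support_subseq eIn) re.
    by rewrite mem_primes_desc => /andP[pr rY]; rewrite dvdn_prime2 // => /eqP ->.
  - by rewrite filter_uniq ?iota_uniq.
  by rewrite eqxx mulr1 lerDl sumr_ge0 // => m _; rewrite mulr_ge0.
rewrite exchange_big /=.
under eq_bigr do rewrite exchange_big /=.
rewrite exchange_big /= mulr_sumr big_nat_cond [X in _ <= X]big_nat_cond.
apply: ler_sum => m /andP[/andP[m0 mN] _].
under eq_bigr do rewrite -mulr_sumr.
rewrite -mulr_sumr mulrC ler_wpM2r //.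
apply: le_trans (Qcount m m0 _); last by rewrite -truncn_ge_nat.
apply: le_trans (count_dvd_subsets R (primes_desc Y) 0 m).
rewrite big_seq [X in _ <= X]big_seq; apply: ler_sum => e eIn.
case: (boolP (_ %| m)%N) => dv; last first.
  rewrite big1 // => w _; case: eqP => // mE.
  by rewrite mE dvdn_mull in dv.
case: (pselect (exists w, m = mul w e)) => [[w mE]|noW]; last first.
  by rewrite big1 // => w _; case: eqP => // mE; case: noW; exists w.
rewrite (bigD1 w) //= mE eqxx big1 ?addr0 // => w' w'w.
case: eqP => // /eqP; rewrite eqn_pmul2r ?prod_gt0 // => /eqP/box_number_inj ww'.
by rewrite ww' eqxx in w'w.
Qed.

(** With [alpha = ln T / ln y] the left-hand side is the moment of order [alpha] of
    [\prod_p p ^ Geom_p] over the vectors with exponents at most [M]. It factors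
    into one truncated geometric series for each prime. *)
Lemma sum_box_moment (eta T : R) : 2 <= y -> 0 < eta -> 1 <= T ->
  ln T <= (1 - eta) * ln y ->
  \sum_(w : box) (number w)%:R^-1 * euler_product *
     expR (ln T / ln y * ln (number w)%:R) <=
  expR (2 / (1 - expR (- eta * ln 2)) * (T * ln T)).
Proof.
move=> y2 eta0 T1 Ty.
have Y0 : (0 < Y)%N by rewrite truncn_gt0 (le_trans _ y2) // ler1n.
have y1 : 1 < y by rewrite (lt_le_trans _ y2) // ltr1n.
have y0 : 0 <= y by rewrite ltW // (lt_trans ltr01).
apply: le_trans (euler_product_moment Y0 _ eta0 T1 y1 Ty); last first.
  by rewrite truncn_le.
have lny : 0 < ln y by rewrite ln_gt0.
set alpha := ln T / ln y.
have alpha1 : alpha < 1 by rewrite ltr_pdivrMr // mul1r (le_lt_trans Ty) //; nra.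
pose rho (q : nat) : R := expR (alpha * ln q%:R) / q%:R.
have pow_number (w : box) : expR (alpha * ln (number w)%:R) =
    \prod_(p : I) expR (alpha * ln (prime_val p)%:R) ^+ w p.
  rewrite /smooth_number natr_prod.
  suff [] : 0 < \prod_(p : I) (p ^ w p)%N%:R :> R /\
     expR (alpha * ln (\prod_(p : I) (p ^ w p)%N%:R)) =
     \prod_(p : I) expR (alpha * ln (prime_val p)%:R) ^+ w p by [].
  elim/big_rec2: _ => [|p a b _ [b0 <-]]; first by rewrite ln1 mulr0 expR0.
  have p0 : 0 < (prime_val p)%:R :> R by rewrite ltr0n prime_gt0 ?prime_upto_prime.
  rewrite natrX; split; first by rewrite mulr_gt0 ?exprn_gt0.
  rewrite lnM ?posrE ?exprn_gt0 // mulrDr expRD lnXn // -expRM_natl.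
  by congr (expR _ * _); rewrite -[ln _ *+ _]mulr_natl mulrCA.
rewrite -(big_prime_upto y _ (fun q => (1 - q%:R^-1) / (1 - rho q))) /=.
have -> : \sum_(w : box) (number w)%:R^-1 * euler_product *
     expR (alpha * ln (number w)%:R) =
   \prod_(p : I) \sum_(k < M.+1) (1 - (prime_val p)%:R^-1) * rho p ^+ k.
  rewrite bigA_distr_bigA; apply: eq_bigr => w _.
  rewrite pow_number -geometric_density -big_split /=; apply: eq_bigr => p _.
  by rewrite /rho expr_div_n [RHS]mulrCA [LHS]mulrC [X in _ * X = _]mulrC.
apply: ler_prod => p _.
have pp := prime_upto_prime p.
have q0 : 0 < (prime_val p)%:R :> R by rewrite ltr0n prime_gt0.
have q1 : 0 <= 1 - (prime_val p)%:R^-1 :> R.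
  by rewrite subr_ge0 invf_le1 // ler1n prime_gt0.
have rho0 : 0 <= rho (prime_val p) by rewrite divr_ge0 ?expR_ge0 // ltW.
have rho1 : rho (prime_val p) < 1.
  rewrite ltr_pdivrMr // mul1r -[X in _ < X](@lnK R) ?posrE // ltr_expR.
  by rewrite gtr_pMl // ln_gt0 // ltr1n prime_gt1.
rewrite -mulr_sumr mulr_ge0 ?sumr_ge0 //=; last by move=> k _; rewrite exprn_ge0.
rewrite ler_wpM2l // -[X in _ <= X]mul1r ler_pdivlMr ?subr_gt0 //.
have := subrX1 (rho (prime_val p)) M.+1; have := exprn_ge0 M.+1 rho0.
by rewrite mulrC; lra.
Qed.
End Box.

Lemma mul_brun_support_le (n b B : nat) (N : R) (e : seq nat) :
  2 <= y -> 0 < N -> (0 < n)%N -> (0 < B)%N ->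
  (b%:R + 2 * B%:R) * ln y <= ln N - ln n%:R ->
  e \in brun_support (brun_allowed Y b B) (primes_desc Y) 0 ->
  (n * \prod_(q <- e) q)%N%:R <= N.
Proof.
move=> y2 N0 n0 B0 room eIn.
have Y0 : (0 < Y)%N by rewrite truncn_gt0 (le_trans _ y2) // ler1n.
have y0 : 0 < y by rewrite (lt_le_trans _ y2).
have prod0 : (0 < \prod_(q <- e) q)%N.
  have := mem_subseq (brun_support_subseq eIn) => sub.
  rewrite big_seq prodn_cond_gt0 // => q /sub; rewrite mem_primes_desc.
  by move=> /andP[/prime_gt0].
have lnY : ln Y%:R <= ln y by rewrite ler_ln ?posrE ?ltr0n // truncn_le ltW.
have c0 : 0 <= b%:R + 2 * B%:R :> R by rewrite addr_ge0 // mulr_ge0.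
have := le_trans (prod_brun_support_le R Y0 B0 eIn) (ler_wpM2l c0 lnY).
move=> /le_trans/(_ room) lnprod.
rewrite natrM -ler_ln ?posrE ?mulr_gt0 ?ltr0n //.
by rewrite lnM ?posrE ?ltr0n // addrC -lerBrDr.
Qed.

(** For a vector [v] with [n = smooth_number v], the sieve is used with a number
    [b] of unrestricted choices such that all the products tested are at most
    [N / n]. When no such [b] exists, [N / n] is so small that the first term of
    the bound exceeds the density of [v]. *)
Lemma point_mass_lower_bound (v : I -> nat) (D : nat -> R) (pX : R)
    (N T : R) (B : nat) :
  2 <= y -> 0 < N -> 4^-1 <= ln T -> 32 * (T + 2) <= B%:R -> 0 <= pX ->
  (forall allowed, \sum_(e <- brun_support allowed (primes_desc Y) 0)
     (-1) ^+ size e * D (smooth_number v * \prod_(q <- e) q)%N <= pX) ->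
  (smooth_number v)%:R^-1 * euler_product - pX <=
  (smooth_number v)%:R^-1 * euler_product *
    (8 * T ^+ (2 * B).+1 * 
       expR (- (ln T / ln y * (ln N - ln (smooth_number v)%:R)))) +
  \sum_(e <- brun_support (fun _ _ => true) (primes_desc Y) 0)
     (if (smooth_number v * \prod_(q <- e) q)%N%:R <= N then
        `|D (smooth_number v * \prod_(q <- e) q)%N
          - (smooth_number v * \prod_(q <- e) q)%N%:R^-1|
      else 0).
Proof.
move=> y2 N0 lnT BT pX0 sieve.
have Y0 : (0 < Y)%N by rewrite truncn_gt0 (le_trans _ y2) // ler1n.
have y1 : 1 < y by rewrite (lt_le_trans _ y2) // ltr1n.
have y0 : 0 < y by rewrite (lt_trans ltr01).
have lny : 0 < ln y by rewrite ln_gt0.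
have T0 : 0 < T by rewrite ltNge; apply/negP => /ln0 lnT0; move: lnT; rewrite lnT0; lra.
have T1 : 1 <= T by rewrite -ler_ln ?posrE // ln1; lra.
have B0 : (0 < B)%N by rewrite -(ltr_nat R); lra.
set n := smooth_number v; have n0 : (0 < n)%N := smooth_number_gt0 v.
have nR0 : 0 < n%:R :> R by rewrite ltr0n.
set V := euler_product; have V0 : 0 <= V := euler_product_ge0.
set rem := \sum_(e <- _) _.
have rem0 : 0 <= rem by rewrite sumr_ge0 // => e _; case: ifP.
have nV0 : 0 <= n%:R^-1 * V by rewrite mulr_ge0 // invr_ge0 ltW.
set beta := (ln N - ln n%:R) / ln y.
have -> : ln T / ln y * (ln N - ln n%:R) = beta * ln T.
  by rewrite /beta; field; rewrite gt_eqF.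
have TE k : T ^+ k = expR (k%:R * ln T) by rewrite expRM_natl lnK.
(* With fewer than [2 * B] units of room the sieve cannot run, but then the
   first term of the bound is at least the density of [v]. *)
case: (ltP beta (2 * B%:R)) => betaB.
  have : 1 <= 8 * T ^+ (2 * B).+1 * expR (- (beta * ln T)).
    rewrite TE -mulrA -expRD.
    have : 1 <= expR ((2 * B).+1%:R * ln T + - (beta * ln T)).
      rewrite -{1}expR0 ler_expR -mulrBl mulr_ge0 //; last lra.
      by rewrite -natr1 natrM; lra.
    lra.
  move=> /(ler_wpM2l nV0); lra.
set b := Num.truncn (beta - 2 * B%:R).
have bP : b%:R <= beta - 2 * B%:R by rewrite truncn_le; lra.
have bP' : beta - 2 * B%:R < b.+1%:R by exact: truncnS_gt.
have Tb : T ^- b <= T ^+ (2 * B).+1 * expR (- (beta * ln T)).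
  rewrite !TE -expRN -expRD ler_expR -[- (b%:R * _)]mulNr -[- (beta * _)]mulNr -mulrDl ler_wpM2r //; first lra.
  have B1 : (2 * B).+1%:R = 2 * B%:R + 1 :> R by rewrite -natr1 natrM.
  by move: bP'; rewrite B1 -[b.+1%:R]natr1; lra.
have := sieve (brun_allowed Y b B).
have := brun_density b Y0 lnT BT.
set supp := brun_support _ _ _.
pose mul (e : seq nat) := (n * \prod_(q <- e) q)%N.
have room : (b%:R + 2 * B%:R) * ln y <= ln N - ln n%:R.
  by rewrite -ler_pdivlMr // -/beta -lerBrDr.
have mul_le e : e \in supp -> (mul e)%:R <= N.
  exact: mul_brun_support_le.
clearbody b beta.
have -> : brun_sum (brun_allowed Y b B) (fun q => q%:R^-1 : R) (primes_desc Y) 0 =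
   n%:R * \sum_(e <- supp) (-1) ^+ size e * (mul e)%:R^-1.
  rewrite /brun_sum mulr_sumr; apply: eq_bigr => e _.
  rewrite prodfV -natr_prod /mul natrM invfM mulrCA; congr (_ * _).
  by rewrite mulrA divff ?mul1r // gt_eqF.
rewrite -ler_pdivrMl // => density sieve_le.
have rem_le : \sum_(e <- supp) `|D (mul e) - (mul e)%:R^-1| <= rem.
  rewrite /rem; apply: (@le_trans _ _ (\sum_(e <- supp)
    (if (mul e)%:R <= N then `|D (mul e) - (mul e)%:R^-1| else 0))).
    by rewrite big_seq [X in _ <= X]big_seq; apply: ler_sum => e /mul_le ->.
  apply: (ler_sum_brun_support _
    (f := fun e => if (mul e)%:R <= N then `|D (mul e) - (mul e)%:R^-1| else 0)).
  by move=> e; case: ifP.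
have : \sum_(e <- supp) (-1) ^+ size e * (mul e)%:R^-1 -
   \sum_(e <- supp) (-1) ^+ size e * D (mul e) <= rem.
  apply: le_trans rem_le; rewrite -sumrB; apply: ler_sum => e _.
  rewrite -mulrBr distrC; apply: le_trans (ler_norm _) _.
  by rewrite normrM normrX normrN1 expr1n mul1r.
have : n%:R^-1 * V * (8 * T ^- b) <= 
    n%:R^-1 * V * (8 * T ^+ (2 * B).+1 * expR (- (beta * ln T))).
  by rewrite ler_wpM2l // -mulrA ler_wpM2l.
move: density sieve_le; rewrite -/V -/n; rewrite mulrBr mulr1 mulrA => density.
rewrite -/(mul _) in density *; lra.
Qed.

End MainInequality.

(** * Discrete laws *)

Section ProbabilityFacts.
Variables (R : realType) (d : measure_display) (T : measurableType d).
Variable P : probability T R.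
Implicit Types A B : set T.

Lemma fineP A : measurable A -> P A = (fine (P A))%:E.
Proof. by move=> mA; rewrite fineK // fin_num_measure. Qed.

Lemma fine_prob_ge0 A : 0 <= fine (P A).
Proof. exact: fine_ge0. Qed.

Lemma fine_prob_le1 A : measurable A -> fine (P A) <= 1.
Proof. by move=> mA; rewrite -lee_fin -fineP // probability_le1. Qed.

Lemma fine_probC A : measurable A -> fine (P (~` A)) = 1 - fine (P A).
Proof. by move=> mA; rewrite probability_setC // (fineP mA). Qed.

Lemma fine_prob_bigsetU_le (I : Type) (s : seq I) (C : pred I) (F : I -> set T) :
  (forall i, measurable (F i)) ->
  fine (P (\big[setU/set0]_(i <- s | C i) F i)) <=
  \sum_(i <- s | C i) fine (P (F i)).
Proof.
move=> mF.
suff [] : measurable (\big[setU/set0]_(i <- s | C i) F i) /\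
  fine (P (\big[setU/set0]_(i <- s | C i) F i)) <=
  \sum_(i <- s | C i) fine (P (F i)) by [].
elim/big_rec2: _ => [|i a A _ [mA le_a]]; first by rewrite measure0.
split; first exact: measurableU.
apply: (@le_trans _ _ (fine (P (F i)) + fine (P A))); last by rewrite lerD2l.
rewrite -lee_fin EFinD -!fineP //; first exact: measureU2.
exact: measurableU.
Qed.

Lemma measurable_RV_nat (X : {RV P >-> nat}) (S : set nat) :
  measurable (X @^-1` S).
Proof. exact: measurable_funPTI. Qed.

Lemma law_nat_below (X : {RV P >-> nat}) (n : nat) (S : set nat) :
  fine (P (X @^-1` (S `&` [set a | a <= n]%N))) =
  \sum_(a < n.+1) fine (P (X @^-1` [set nat_of_ord a])) * (nat_of_ord a \in S)%:R.
Proof.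
have -> : X @^-1` (S `&` [set a | a <= n]%N) =
    \big[setU/set0]_(a < n.+1 | nat_of_ord a \in S) (X @^-1` [set nat_of_ord a]).
  rewrite -bigcup_seq_cond; apply/seteqP; split=> t /=.
    case=> /mem_set St Xn; exists (Ordinal (Xn : (X t < n.+1)%N)) => //=.
    by rewrite mem_index_enum.
  by case=> a /= /andP[_ /set_mem Sa] ->; split => //; rewrite -ltnS.
rewrite measure_bigsetU_ord_cond; last 2 first.
- by move=> a _; exact: measurable_RV_nat.
- by move=> a b _ _ [t [/= Xa Xb]]; apply/val_inj; rewrite /= -Xa.
rewrite -sum_fine; last by move=> a _; rewrite fin_num_measure //; exact: measurable_RV_nat.
rewrite big_mkcond; apply: eq_bigr => a _.
by case: ifP => _; rewrite ?mulr1 ?mulr0.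
Qed.

Lemma law_bounded_nat (X : {RV P >-> nat}) (n : nat) (S : set nat) :
  (forall t, X t <= n)%N ->
  fine (P (X @^-1` S)) =
  \sum_(a < n.+1) fine (P (X @^-1` [set nat_of_ord a])) * (nat_of_ord a \in S)%:R.
Proof.
move=> Xn; rewrite -law_nat_below; congr (fine (P _)).
by apply/seteqP; split=> t /=; [split|case].
Qed.
End ProbabilityFacts.

Lemma dTV_le (R : realType) (Omega : countType)
    (d1 : measure_display) (T1 : measurableType d1) (P1 : probability T1 R)
    (X : T1 -> Omega)
    (d2 : measure_display) (T2 : measurableType d2) (P2 : probability T2 R)
    (Y : T2 -> Omega) (b : R) :
  (forall E, `|fine (P1 (X @^-1` E)) - fine (P2 (Y @^-1` E))| <= b) ->
  dTV P1 X P2 Y <= b.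
Proof.
move=> Eb; apply: ge_sup; first by eexists; exists setT.
by move=> _ [E _ <-].
Qed.

(** Passing to the complement of [E], a one-sided bound suffices. *)
Lemma dTV_le_onesided (R : realType) (Omega : countType)
    (d1 : measure_display) (T1 : measurableType d1) (P1 : probability T1 R)
    (X : T1 -> Omega)
    (d2 : measure_display) (T2 : measurableType d2) (P2 : probability T2 R)
    (Y : T2 -> Omega) (b : R) :
  (forall E, measurable (X @^-1` E)) -> (forall E, measurable (Y @^-1` E)) ->
  (forall E, fine (P2 (Y @^-1` E)) - fine (P1 (X @^-1` E)) <= b) ->
  dTV P1 X P2 Y <= b.
Proof.
move=> mX mY Eb; apply: dTV_le => E; rewrite ler_norml lerNl opprB Eb.
have := Eb (~` E); rewrite -(preimage_setC X) -(preimage_setC Y).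
rewrite (fine_probC P1 (mX E)) (fine_probC P2 (mY E)).
have swap (a c : R) : 1 - a - (1 - c) = c - a by ring.
by rewrite swap.
Qed.

Section GeometricBox.
Variables (R : realType) (y : R) (d : measure_display) (T : measurableType d).
Variables (P : probability T R) (Geom : prime_upto y -> {RV P >-> nat}).
Hypothesis indep : mutually_independent Geom.
Hypothesis geom : forall p : prime_upto y, geometric_law p (Geom p).
Local Notation I := (prime_upto y).

Lemma measurable_family_vector (E : set {ffun I -> nat}) :
  measurable (family_vector Geom @^-1` E).
Proof.
have point (v : {ffun I -> nat}) : measurable (family_vector Geom @^-1` [set v]).
  have -> : family_vector Geom @^-1` [set v] =
      \bigcap_(p in [set: I]) (Geom p @^-1` [set v p]).
    apply/seteqP; split=> t /=; first by move=> <- p _ /=; rewrite ffunE.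
    by move=> vt; apply/ffunP => p; rewrite ffunE; exact: vt.
  apply: fin_bigcap_measurable; first exact: finite_finset.
  by move=> p _; exact: measurable_RV_nat.
have -> : family_vector Geom @^-1` E =
    \bigcup_(v in E) (family_vector Geom @^-1` [set v]).
  apply/seteqP; split=> t /=; first by move=> Et; exists (family_vector Geom t).
  by case=> v Ev /= ->.
rewrite bigcup_mkcond; apply: countable_bigcupT_measurable => [|v].
  exact: countableP.
by case: ifP.
Qed.

Lemma prob_geometric_point (v : {ffun I -> nat}) :
  fine (P (family_vector Geom @^-1` [set v])) =
  (smooth_number v)%:R^-1 * \prod_(q <- primes_desc (Num.truncn y)) (1 - q%:R^-1).
Proof.
rewrite -geometric_density.
have -> : family_vector Geom @^-1` [set v] =
    [set t | forall p, p \in [set: I]%SET -> [set v p] (Geom p t)].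
  apply/seteqP; split=> t /=; first by move=> <- p _; rewrite ffunE.
  by move=> vt; apply/ffunP => p; rewrite ffunE vt ?inE.
rewrite (indep [set: I]%SET (E := fun p => [set v p])) //.
rewrite (eq_bigr (fun p : I => ((prime_val p)%:R ^- v p * (1 - (prime_val p)%:R^-1))%:E)).
  by rewrite prodEFin; apply: eq_bigl => p; rewrite inE.
by move=> p _; rewrite geom.
Qed.

Lemma prob_geometric_gt (p : I) (M : nat) :
  fine (P (Geom p @^-1` [set k | M < k]%N)) <= 2 ^- M.+1.
Proof.
have -> : [set k | M < k]%N = ~` (setT `&` [set k | k <= M]%N).
  apply/seteqP; split=> k /=; rewrite ltnNge; first by move=> /negP kM [_ /kM].
  by move=> notle; apply/negP => kM; apply: notle.
rewrite -preimage_setC fine_probC; last exact: measurable_RV_nat.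
rewrite law_nat_below; set q : R := (prime_val p)%:R^-1.
have q2 : 0 <= q <= 2^-1.
  by rewrite /q invr_ge0 ler0n /= lef_pV2 ?posrE ?ltr0n ?prime_gt0
    ?prime_upto_prime // ler_nat prime_gt1 ?prime_upto_prime.
rewrite (eq_bigr (fun a : 'I_M.+1 => (1 - q) * q ^+ a)); last first.
  move=> a _; rewrite geom /= in_setT mulr1 mulrC /q -exprVn; done.
have := subrX1 q M.+1; rewrite -mulr_sumr.
have : q ^+ M.+1 <= 2^-1 ^+ M.+1 by case/andP: q2 => q0 q2; rewrite lerXn2r ?nnegrE.
rewrite -exprVn; lra.
Qed.

(** Up to the event that some exponent exceeds [M], only finitely many vectors
    matter. *)
Lemma prob_geometric_box_le (M : nat) (E : set {ffun I -> nat}) :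
  fine (P (family_vector Geom @^-1` E)) <=
  #|{: I}|%:R * 2 ^- M.+1 +
  \sum_(w : {ffun I -> 'I_M.+1} | [ffun p => nat_of_ord (w p)] \in E)
    fine (P (family_vector Geom @^-1` [set [ffun p => nat_of_ord (w p)]])).
Proof.
pose large := \big[setU/set0]_(p : I) (Geom p @^-1` [set k | M < k]%N).
pose box := \big[setU/set0]_(w : {ffun I -> 'I_M.+1} |
   [ffun p => nat_of_ord (w p)] \in E)
  (family_vector Geom @^-1` [set [ffun p => nat_of_ord (w p)]]).
have mlarge : measurable large.
  by apply: bigsetU_measurable => p _; exact: measurable_RV_nat.
have mbox : measurable box.
  by apply: bigsetU_measurable => w _; exact: measurable_family_vector.
apply: (@le_trans _ _ (fine (P large) + fine (P box))); last first.
  apply: lerD; last first.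
    by apply: fine_prob_bigsetU_le => w; exact: measurable_family_vector.
  apply: (@le_trans _ _ _ _ _ (fine_prob_bigsetU_le _ _ _ _)).
    by move=> p; exact: measurable_RV_nat.
  apply: (@le_trans _ _ (\sum_(p : I) 2 ^- M.+1)).
    by apply: ler_sum => p _; exact: prob_geometric_gt.
  by rewrite sumr_const mulr_natl.
rewrite -lee_fin EFinD -!fineP //; last exact: measurable_family_vector.
apply: (@le_trans _ _ (P (large `|` box))); last exact: measureU2.
apply: le_measure; rewrite ?inE; [exact: measurable_family_vector|exact: measurableU|].
move=> t /= Et; rewrite /large /box -!bigcup_seq_cond.
case: (pselect (exists p, M < Geom p t)%N) => [[p pM]|small].
  by left; exists p => //=; rewrite mem_index_enum.
have le_M p : (Geom p t < M.+1)%N.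
  by rewrite ltnS leqNgt; apply/negP => pM; apply: small; exists p.
have wE : [ffun p => nat_of_ord ([ffun p => Ordinal (le_M p)] p)] =
    family_vector Geom t by apply/ffunP => p; rewrite !ffunE.
right; exists [ffun p => Ordinal (le_M p)] => /=; last by rewrite wE.
by rewrite mem_index_enum wE; apply/mem_set.
Qed.
End GeometricBox.

(** * The sieve bound for the distance *)

Lemma truncation_arith (R : realType) (a b r s t m D e : R) :
  a <= t + r -> s <= b -> r - s <= m + D -> t <= e -> a - b <= m + D + e.
Proof. lra. Qed.

Section SieveBound.
Variables (R : realType) (x y theta : R).
Variables (d : measure_display) (T : measurableType d) (P : probability T R).
Variable A : {RV P >-> nat}.
Hypothesis Ax : forall t : T, (1 <= A t)%N /\ (A t)%:R <= x.
Variables (d' : measure_display) (T' : measurableType d').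
Variables (P' : probability T' R) (Geom : prime_upto y -> {RV P' >-> nat}).
Hypothesis indep : mutually_independent Geom.
Hypothesis geom : forall p : prime_upto y, geometric_law p (Geom p).
Local Notation I := (prime_upto y).
Local Notation Y := (Num.truncn y).

Local Notation weight a := (fine (P (A @^-1` [set nat_of_ord a]))).

Lemma measurable_valuation_vector (E : set {ffun I -> nat}) :
  measurable (valuation_vector y A @^-1` E).
Proof. exact: (measurable_RV_nat A [set a | E [ffun p : I => logn p a]]). Qed.

Lemma law_le_x (S : set nat) : fine (P (A @^-1` S)) =
  \sum_(a < (Num.truncn x).+1) weight a * (nat_of_ord a \in S)%:R.
Proof.
apply: law_bounded_nat => t; have [_ At] := Ax t.
by rewrite truncn_ge_nat // (le_trans _ At).
Qed.

(** Expectation of [sieve_pointwise]. *)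
Lemma sieve_in_probability (allowed : nat -> nat -> bool)
    (v : {ffun I -> nat}) :
  \sum_(e <- brun_support allowed (primes_desc Y) 0) (-1) ^+ size e *
    fine (P [set t | (smooth_number v * \prod_(q <- e) q %| A t)%N]) <=
  fine (P (valuation_vector y A @^-1` [set v])).
Proof.
rewrite (law_le_x [set a | [ffun p : I => logn p a] = v]).
under eq_bigr => e _ do rewrite (law_le_x
   [set a | (smooth_number v * \prod_(q <- e) q %| a)%N]) mulr_sumr.
rewrite exchange_big /=; apply: ler_sum => a _.
under eq_bigr => e _ do rewrite mulrCA.
rewrite -mulr_sumr; case: (posnP a) => [a0|a0].
  have -> : weight a = 0.
    rewrite (_ : A @^-1` _ = set0) ?measure0 //.
    by apply/seteqP; split=> t //= At; have [] := Ax t; rewrite At a0.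
  by rewrite !mul0r.
rewrite ler_wpM2l ?fine_prob_ge0 //.
have -> : (nat_of_ord a \in [set a | [ffun p : I => logn p a] = v]) =
    [forall p : I, logn p a == v p].
  apply/idP/forallP => [/set_mem /= <- p|av]; first by rewrite ffunE.
  by apply/mem_set/ffunP => p; rewrite ffunE; exact/eqP.
apply: le_trans (sieve_pointwise allowed v a0).
rewrite le_eqVlt; apply/orP; left; apply/eqP; apply: eq_bigr => e _.
by congr (_ * (nat_of_bool _)%:R); apply/idP/idP => [/set_mem|?] //; exact: mem_set.
Qed.

Lemma sum_box_prob_le (M : nat) (E : set {ffun I -> nat}) :
  \sum_(w : {ffun I -> 'I_M.+1} | [ffun p => nat_of_ord (w p)] \in E)
    fine (P (valuation_vector y A @^-1` [set [ffun p => nat_of_ord (w p)]])) <=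
  fine (P (valuation_vector y A @^-1` E)).
Proof.
rewrite (law_le_x [set a | E [ffun p : I => logn p a]]).
under eq_bigr => w _ do rewrite (law_le_x
   [set a | [ffun p : I => logn p a] = [ffun p => nat_of_ord (w p)]]).
rewrite exchange_big /=; apply: ler_sum => a _.
rewrite -mulr_sumr ler_wpM2l ?fine_prob_ge0 //.
case: (pselect (exists2 w : {ffun I -> 'I_M.+1}, [ffun p => nat_of_ord (w p)] \in E &
    [ffun p : I => logn p a] = [ffun p => nat_of_ord (w p)])) => [[w wE aw]|no].
  rewrite (bigD1 w) //= big1 ?addr0.
    have -> : nat_of_ord a \in [set a | E [ffun p : I => logn p a]].
      by apply/mem_set; rewrite /= aw; exact: set_mem wE.
    by case: (_ \in _).
  move=> w' /andP[_ w'w]; case: (boolP (_ \in _)) => // /set_mem /= aw'.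
  have : w' = w; last by move/eqP; rewrite (negbTE w'w).
  apply/ffunP => p; apply/val_inj.
  have := congr1 (fun f : {ffun I -> nat} => f p) aw'.
  by rewrite aw !ffunE.
rewrite big1 ?ler0n // => w wE.
case: (boolP (_ \in _)) => // /set_mem /= aw; by case: no; exists w.
Qed.

(** Summing [point_mass_lower_bound] over all exponent vectors, with
    [N = x ^ theta], leaves [Tr] and [B] as free parameters. *)
Lemma dTV_sieve_bound (eta Tr : R) (B : nat) :
  2 <= y -> y <= x -> theta <= 1 -> 0 < eta -> 4^-1 <= ln Tr ->
  ln Tr <= (1 - eta) * ln y -> 32 * (Tr + 2) <= B%:R -> 6 ^+ 8 <= ln x ->
  dTV P (valuation_vector y A) P' (family_vector Geom) <=
  8 * Tr ^+ (2 * B).+1 * expR (- (ln Tr / ln y * (theta * ln x))) *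
    expR (2 / (1 - expR (- eta * ln 2)) * (Tr * ln Tr)) +
  loglog_factor x * divisibility_discrepancy P A x y theta.
Proof.
move=> y2 yx theta1 eta0 lnTr Try BTr Lx.
have x0 : 0 < x by rewrite (lt_le_trans _ yx) // (lt_le_trans _ y2).
have Tr1 : 1 <= Tr.
  have Tr0 : 0 < Tr.
    by rewrite ltNge; apply/negP => /ln0 lnT0; move: lnTr; rewrite lnT0; lra.
  by rewrite -ler_ln ?posrE // ln1; lra.
have x1 : 1 <= x by rewrite (le_trans _ yx) // (le_trans _ y2) // ler1n.
have y1 : 1 <= y by rewrite (le_trans _ y2) // ler1n.
set N := x `^ theta; have N0 : 0 < N by exact: powR_gt0.
have lnN : ln N = theta * ln x by exact: ln_powR.
have Nx : N <= x by exact: ler1_powR.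
set c := 1 - _.
pose D m := fine (P [set t | (m %| A t)%N]).
pose K : R := 8 * Tr ^+ (2 * B).+1.
have K0 : 0 <= K by rewrite mulr_ge0 // exprn_ge0 // (le_trans ler01).
apply: dTV_le_onesided; first exact: measurable_valuation_vector.
  exact: measurable_family_vector.
move=> E; apply/ler_addgt0Pr => e e0.
(* The exponents are truncated at [M] so large that the lost mass is below
   [e]. *)
pose M := Num.truncn (#|{: I}|%:R / e).
have Me : #|{: I}|%:R * 2 ^- M.+1 <= e.
  rewrite ler_pdivrMr ?exprn_gt0 // mulrC -ler_pdivrMr //.
  apply: (@le_trans _ _ M.+1%:R); first by rewrite ltW // truncnS_gt.
  by rewrite -natrX ler_nat ltnW // ltn_expl.
pose nat_vector (w : {ffun I -> 'I_M.+1}) : {ffun I -> nat} :=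
  [ffun p => nat_of_ord (w p)].
have numberE w : smooth_number (nat_vector w) = smooth_number (fun p => w p).
  by apply: eq_bigr => p _; rewrite ffunE.
pose rem w := \sum_(e <- brun_support (fun _ _ => true) (primes_desc Y) 0)
   (if (smooth_number (nat_vector w) * \prod_(q <- e) q)%N%:R <= N then
      `|D (smooth_number (nat_vector w) * \prod_(q <- e) q)%N
        - (smooth_number (nat_vector w) * \prod_(q <- e) q)%N%:R^-1|
      else 0).
pose main w := fine (P' (family_vector Geom @^-1` [set nat_vector w])) *
   (K * expR (- (ln Tr / ln y * (ln N - ln (smooth_number (nat_vector w))%:R)))).
have rem0 w : 0 <= rem w by rewrite sumr_ge0 // => f _; case: ifP.
have main0 w : 0 <= main w.
  by rewrite mulr_ge0 ?fine_prob_ge0 // mulr_ge0 // expR_ge0.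
have point w : fine (P' (family_vector Geom @^-1` [set nat_vector w])) -
    fine (P (valuation_vector y A @^-1` [set nat_vector w])) <= main w + rem w.
  rewrite /main (prob_geometric_point indep geom).
  apply: point_mass_lower_bound => //; first exact: fine_prob_ge0.
  by move=> allowed; exact: sieve_in_probability.
have highY := prob_geometric_box_le geom M E.
have lowX := sum_box_prob_le M E.
have diff_le : \sum_(w | nat_vector w \in E)
      fine (P' (family_vector Geom @^-1` [set nat_vector w])) -
    \sum_(w | nat_vector w \in E)
      fine (P (valuation_vector y A @^-1` [set nat_vector w])) <=
    \sum_w main w + \sum_w rem w.
  rewrite -sumrB -big_split /=; apply: (@le_trans _ _
     (\sum_(w | nat_vector w \in E) (main w + rem w))).
    by apply: ler_sum => w _; exact: point.
  rewrite big_mkcond; apply: ler_sum => w _.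
  by case: ifP => // _; rewrite addr_ge0.
have main_le : \sum_w main w <= K * expR (- (ln Tr / ln y * (theta * ln x))) *
    expR (2 / c * (Tr * ln Tr)).
  rewrite -lnN.
  apply: le_trans (ler_wpM2l _ (sum_box_moment M y2 eta0 Tr1 Try)); last first.
    by rewrite mulr_ge0 // expR_ge0.
  rewrite mulr_sumr le_eqVlt; apply/orP; left; apply/eqP; apply: eq_bigr => w _.
  rewrite /main (prob_geometric_point indep geom) numberE.
  have swap (a b1 b2 : R) : - (a * (b1 - b2)) = - (a * b1) + a * b2 by ring.
  have shuffle (a b f g h : R) : a * b * (f * g * h) = f * g * (a * (b * h)).
    by ring.
  by rewrite swap expRD -shuffle.
have rem_le : \sum_w rem w <=
    loglog_factor x * divisibility_discrepancy P A x y theta.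
  apply: le_trans (sum_sieve_remainders M (N := N) (Q := loglog_factor x)
    (Delta := fun m => `|D m - m%:R^-1|) y1 (ltW N0) _ _) => //; last first.
    by move=> m m0 mN; apply: two_expn_count_primes => //; exact: le_trans Nx.
  rewrite le_eqVlt; apply/orP; left; apply/eqP.
  by apply: eq_bigr => w _; apply: eq_bigr => f _; rewrite numberE.
exact: truncation_arith highY lowX (le_trans diff_le (lerD main_le rem_le)) Me.
Qed.
End SieveBound.

(** * Choice of the Rankin parameter *)

Section Asymptotics.
Variable R : realType.

Lemma ln2_ge_half : 2^-1 <= ln 2 :> R.
Proof.
have := expR_ge1Dx (- 2^-1 : R); rewrite expRN => h.
have := ler_wpM2l (expR_ge0 (2^-1 : R)) h.
by rewrite divff ?gt_eqF ?expR_gt0 // -ler_expR lnK ?posrE //; lra.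
Qed.

(** The Rankin parameter: [u ^ (1 - eta)], but never more than [y ^ (1 - eta)],
    in order that the Euler product converges. *)
Definition rankin (eta u y : R) : R := expR ((1 - eta) * Num.min (ln u) (ln y)).

(** The hypothesis on [K] absorbs the terms of size [O(rankin)] in the exponent
    into a fraction [eta] of [theta * u], and [(1 - eta) ^ 2 >= 1 - eps]. The two
    terms on the right correspond to the two values of the minimum, as
    [u * ln y = ln x]. *)
Lemma rankin_decay (theta eps x y K : R) :
  let eta := eps / 2 in let u := ln x / ln y in
  0 < theta -> 0 < eps -> eps < 1 -> 2 <= y -> y <= x -> 1 <= u ->
  K * rankin eta u y <= eta * theta * u ->
  expR (ln (rankin eta u y) * (K * rankin eta u y - theta * u)) <=
  u `^ (- (theta * u * (1 - eps))) + x `^ (- (theta * (1 - eps))).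
Proof.
move=> eta u theta0 eps0 eps1 y2 yx u1 KT.
have y0 : 0 < y by rewrite (lt_le_trans _ y2).
have x0 : 0 < x by rewrite (lt_le_trans _ yx).
have lny : 0 < ln y by rewrite ln_gt0 // (lt_le_trans _ y2) // ltr1n.
have u0 : 0 < u by rewrite (lt_le_trans ltr01).
have lnu : 0 <= ln u by rewrite ln_ge0.
rewrite /rankin expRK -/(rankin eta u y).
set mn := Num.min (ln u) (ln y).
have mn0 : 0 <= mn by rewrite le_min lnu ltW.
have eta2 : eta = eps / 2 by [].
have tau0 : 0 <= (1 - eta) * mn by rewrite mulr_ge0 //; lra.
have tu0 : 0 <= theta * u by rewrite mulr_ge0 // ltW.
have step1 : (1 - eta) * mn * (K * rankin eta u y - theta * u) <=
    - ((1 - eps) * (mn * (theta * u))).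
  have : (1 - eta) * mn * (K * rankin eta u y) <= (1 - eta) * mn * (eta * theta * u).
    by rewrite ler_wpM2l.
  have : 0 <= eta ^+ 2 * (mn * (theta * u)).
    by rewrite mulr_ge0 ?sqr_ge0 // mulr_ge0.
  have -> : eps = 2 * eta by rewrite eta2; field.
  lra.
apply: le_trans (_ : expR (- ((1 - eps) * (mn * (theta * u)))) <= _).
  by rewrite ler_expR.
rewrite /powR !gt_eqF //.
case: (leP (ln u) (ln y)) => [uy|yu]; rewrite /mn.
  rewrite (min_idPl uy) ler_wpDr ?expR_ge0 // ler_expR.
  by rewrite le_eqVlt; apply/orP; left; apply/eqP; ring.
rewrite (min_idPr (ltW yu)) ler_wpDl ?expR_ge0 // ler_expR.
by rewrite le_eqVlt; apply/orP; left; apply/eqP; rewrite /u; field; rewrite gt_eqF.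
Qed.

Lemma rankin_le (eta u y K L : R) : 0 < eta -> eta < 1 -> 0 < K -> 0 < L ->
  0 < u -> ln (K / L) / eta <= ln u -> K * rankin eta u y <= L * u.
Proof.
move=> eta0 eta1 K0 L0 u0; rewrite ler_pdivrMr // => big_u.
have KL : 0 < K / L by rewrite divr_gt0.
have le1 : rankin eta u y <= expR (- ln (K / L)) * u.
  rewrite -[X in _ <= _ * X](lnK (x := u)) ?posrE // -expRD ler_expR.
  apply: (@le_trans _ _ ((1 - eta) * ln u)); last lra.
  by rewrite ler_wpM2l ?ge_min ?lexx //; lra.
have := ler_wpM2l (ltW K0) le1; rewrite expRN lnK ?posrE //.
by rewrite mulrA invf_div mulrCA divff ?mulr1 // gt_eqF.
Qed.
End Asymptotics.

Section TrivialBounds.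
Variables (R : realType) (x y : R).
Variables (d : measure_display) (T : measurableType d) (P : probability T R).
Variable A : {RV P >-> nat}.
Variables (d' : measure_display) (T' : measurableType d').
Variables (P' : probability T' R) (Geom : prime_upto y -> {RV P' >-> nat}).

Lemma dTV_le1 : dTV P (valuation_vector y A) P' (family_vector Geom) <= 1.
Proof.
apply: dTV_le_onesided; first exact: measurable_valuation_vector.
  exact: measurable_family_vector.
move=> E; rewrite lerBlDr (le_trans (fine_prob_le1 _ _)) //.
  exact: measurable_family_vector.
by rewrite lerDl fine_prob_ge0.
Qed.

Lemma loglog_discrepancy_ge0 theta :
  0 <= loglog_factor x * divisibility_discrepancy P A x y theta.
Proof. by rewrite mulr_ge0 ?powR_ge0 // sumr_ge0. Qed.
End TrivialBounds.

Unset Implicit Arguments.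

Theorem corollary2p1 (R : realType) (theta eps : R)
    (htheta0 : 0 < theta) (htheta1 : theta < 1) (heps : 0 < eps) :
  exists C : R, 0 < C /\
  forall (x y : R), 2 <= y -> y <= x ->
  forall (d : measure_display) (T : measurableType d) (P : probability T R)
    (A : {RV P >-> nat}),
  (forall t : T, (1 <= A t)%N /\ (A t)%:R <= x) ->
  forall (d' : measure_display) (T' : measurableType d')
    (P' : probability T' R) (Geom : prime_upto y -> {RV P' >-> nat}),
  mutually_independent Geom ->
  (forall p : prime_upto y, geometric_law p (Geom p)) ->
  let u := ln x / ln y in
  dTV P (valuation_vector y A) P' (family_vector Geom) <=
    C * (u `^ (- (theta * u * (1 - eps)))
         + x `^ (- (theta * (1 - eps)))
         + loglog_factor x * divisibility_discrepancy P A x y theta).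
Proof.
(* [K] collects the terms of size [O(Tr)] in the exponent: [2 * B + 1 <= 200 * Tr]
   from the sieve, and the moment. *)
pose eta := eps / 2; pose c := 1 - expR (- eta * ln 2) : R.
pose K := 200 + 2 / c.
(* From [U0] on, [ln u >= ln 2] and [K * u ^ (1 - eta) <= eta * theta * u]. *)
pose U0 := 2 + expR (ln (K / (eta * theta)) / eta).
pose X0 : R := expR (6 ^+ 8).
exists (8 + X0 + expR (U0 * ln U0)).
have X00 : 0 < X0 by exact: expR_gt0.
have E00 : 0 < expR (U0 * ln U0) by exact: expR_gt0.
split; first by rewrite !addr_gt0.
move=> x y y2 yx d T P A Ax d' T' P' Geom indep geom; cbv zeta.
set u := ln x / ln y.
have y0 : 0 < y by rewrite (lt_le_trans _ y2).
have x0 : 0 < x by rewrite (lt_le_trans _ yx).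
have x1 : 1 <= x by rewrite (le_trans _ yx) // (le_trans _ y2) // ler1n.
have lny : 0 < ln y by rewrite ln_gt0 // (lt_le_trans _ y2) // ltr1n.
have u1 : 1 <= u by rewrite /u ler_pdivlMr // mul1r ler_ln ?posrE.
have u0 : 0 < u by rewrite (lt_le_trans ltr01).
have lnu : 0 <= ln u by rewrite ln_ge0.
have tu0 : 0 <= theta * u := mulr_ge0 (ltW htheta0) (ltW u0).
have D0 := loglog_discrepancy_ge0 x y A theta.
set Disc := loglog_factor x * _ in D0 *.
set F := u `^ _; set G := x `^ _.
have F0 : 0 <= F by exact: powR_ge0.
have G0 : 0 <= G by exact: powR_ge0.
have S0 : 0 <= F + G + Disc by rewrite !addr_ge0.
have FS : F <= F + G + Disc by rewrite -addrA lerDl addr_ge0.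
have GS : G <= F + G + Disc by rewrite addrAC lerDr addr_ge0.
set C := 8 + X0 + _.
have C8 : 8 <= C by rewrite /C -addrA lerDl addr_ge0 // ltW.
have CX : X0 <= C by rewrite /C addrAC lerDr addr_ge0 // ltW.
have CE : expR (U0 * ln U0) <= C by rewrite /C lerDr addr_ge0 // ltW.
(* Outside the main range one of the first two terms is bounded below. *)
have trivial : 1 <= expR (U0 * ln U0) * F \/ 1 <= X0 * G \/ 1 <= F ->
   dTV P (valuation_vector y A) P' (family_vector Geom) <= C * (F + G + Disc).
  move=> big_term; apply: (le_trans (dTV_le1 A Geom)).
  case: big_term => [|[|]] big_term; apply: (le_trans big_term).
  - by apply: ler_pM => //; exact: ltW.
  - by apply: ler_pM => //; exact: ltW.
  - by apply: (le_trans FS); rewrite ler_peMl // (le_trans _ C8) // ler1n.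
clearbody C.
have [eps1|eps1] := leP 1 eps.
  apply: trivial; right; right; rewrite /F -[X in X <= _](powRr0 u) ler_powR //.
  by rewrite oppr_ge0; apply: mulr_ge0_le0; rewrite // subr_le0.
have eps0 : 0 <= 1 - eps by rewrite subr_ge0 ltW.
have t1 : theta * (1 - eps) <= 1 by rewrite mulr_ile1 ?(ltW htheta0) ?(ltW htheta1) // gerBl ltW.
have [uU|uU] := ltP u U0.
  apply: trivial; left; rewrite /F /powR gt_eqF // -expRD -[X in X <= _]expR0 ler_expR.
  have U01 : 1 <= U0 by rewrite (le_trans u1) // ltW.
  have lnU : ln u <= ln U0 by rewrite ler_ln ?posrE ?(lt_le_trans ltr01) // ltW.
  have : theta * u * (1 - eps) * ln u <= U0 * ln U0.
    apply: ler_pM => //; first by rewrite mulr_ge0.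
    rewrite mulrAC (le_trans _ (ltW uU)) // ler_piMl // ltW //.
  lra.
have [xX|xX] := ltP x X0.
  apply: trivial; right; left; rewrite /G powRN -ler_pdivrMr ?invr_gt0 ?powR_gt0 //.
  rewrite invrK mul1r (le_trans _ (ltW xX)) // ler1_powR //.
have lnx : 6 ^+ 8 <= ln x.
  by rewrite -(expRK (6 ^+ 8)) ler_ln ?posrE.
have ln2 := ln2_ge_half R.
have lny2 : 2^-1 <= ln y by rewrite (le_trans ln2) // ler_ln ?posrE.
have eta0 : 0 < eta by rewrite divr_gt0.
have eta12 : eta <= 2^-1 by rewrite /eta; lra.
have c0 : 0 < c.
  by rewrite subr_gt0 expR_lt1 mulNr oppr_lt0 mulr_gt0 //; lra.
have K0 : 0 < K by rewrite addr_gt0 // divr_gt0.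
have lnu2 : 2^-1 <= ln u.
  rewrite (le_trans ln2) // ler_ln ?posrE //.
  by rewrite (le_trans _ uU) // lerDl expR_ge0.
have lnuK : ln (K / (eta * theta)) / eta <= ln u.
  rewrite -[X in X <= _]expRK ler_ln ?posrE ?expR_gt0 //.
  by rewrite (le_trans _ uU) // lerDr.
set Tr := rankin eta u y.
have KTr : K * Tr <= eta * theta * u.
  by apply: rankin_le => //; [lra|rewrite mulr_gt0].
have lnTr : ln Tr = (1 - eta) * Num.min (ln u) (ln y) by rewrite /Tr expRK.
have lnTr4 : 4^-1 <= ln Tr.
  have : 2^-1 <= Num.min (ln u) (ln y) by rewrite le_min lnu2.
  rewrite lnTr; move: (Num.min _ _) => m hm.
  have : 2^-1 * 2^-1 <= (1 - eta) * m by rewrite ler_pM //; lra.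
  lra.
have Tr_y : ln Tr <= (1 - eta) * ln y.
  by rewrite lnTr ler_wpM2l ?ge_min ?lexx ?orbT //; lra.
have Tr1 : 1 <= Tr.
  rewrite /Tr /rankin -[X in X <= _]expR0 ler_expR -lnTr; lra.
pose B := (Num.truncn (32 * (Tr + 2))).+1.
have B_lo : 32 * (Tr + 2) <= B%:R by rewrite ltW // truncnS_gt.
have B_hi : (2 * B).+1%:R <= 200 * Tr.
  have : (Num.truncn (32 * (Tr + 2)))%:R <= 32 * (Tr + 2).
    by rewrite truncn_le; lra.
  rewrite -[(2 * B).+1%:R]natr1 natrM /B -[(Num.truncn _).+1%:R]natr1; lra.
apply: le_trans (dTV_sieve_bound Ax indep geom y2 yx (ltW htheta1) eta0 lnTr4
  Tr_y B_lo lnx) _.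
rewrite -/c -/Disc.
have main : Tr ^+ (2 * B).+1 * expR (- (ln Tr / ln y * (theta * ln x))) *
    expR (2 / c * (Tr * ln Tr)) <= F + G.
  apply: le_trans (rankin_decay htheta0 heps eps1 y2 yx u1 KTr).
  have Tr0 : 0 < Tr by exact: expR_gt0.
  rewrite -/Tr -/u -{1}(lnK (x := Tr)) ?posrE // -expRM_natl -!expRD ler_expR.
  have -> : ln Tr / ln y * (theta * ln x) = ln Tr * (theta * u).
    by rewrite /u; field; rewrite gt_eqF.
  have : (2 * B).+1%:R * ln Tr <= 200 * Tr * ln Tr by rewrite ler_wpM2r //; lra.
  rewrite /K; lra.
apply: (@le_trans _ _ (8 * (F + G + Disc))); last by rewrite ler_wpM2r.
rewrite -!(mulrA 8) [X in _ <= X]mulrDr; apply: lerD; first by rewrite ler_pM2l.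
by rewrite ler_peMl // ler1n.
Qed.
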